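(* Let $C\ge1$, and for $1\le i\le C$ let $N_i\in\{1,2,\dots\}\cup\{\infty\}$ and let $\mathcal{S}_i$ be a Polish space. Let $(X_{n,i})_{1\le n\le N_i,\,1\le i\le C}$ be a multi-exchangeable system, $X_{n,i}$ taking values in $\mathcal{S}_i$, and let $(\Lambda_i^{N_i})_{1\le i\le C}$ be its measure vector (defined below). Then, for $1\le i\le C$, the measure $Q_i$ defined by $Q_i = \lambda^{N_i,N_i}(X_{1,i},\dots,X_{N_i,i})$ if $N_i<\infty$ and $Q_i=(\Lambda_i^{\infty})^{\otimes\infty}$ if $N_i=\infty$ is a measurable function of $\Lambda_i^{N_i}$, and the conditional law of the whole system $(X_{n,i})_{1\le n\le N_i,\,1\le i\le C}$ given $(\Lambda_i^{N_i})_{1\le i\le C}$ is the product measure $Q_1\otimes\cdots\otimes Q_C$. In words: conditionally on $(\Lambda_i^{N_i})_{1\le i\le C}$, the classes are independent, each finite class $i$ being distributed as $N_i$ draws without replacement from the atoms of the empirical measure $\frac1{N_i}\sum_{n=1}^{N_i}\delta_{X_{n,i}}$ counted with multiplicity, and each infinite class being i.i.d. with law its directing measure $\Lambda_i^\infty$.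
   Context: For $k\ge1$, $\Sigma(k)$ is the set of permutations of $\{1,\dots,k\}$ and $\Sigma(\infty)$ is the set of permutations of $\{1,2,\dots\}$ with finite support; $1\le n\le\infty$ means $n\ge1$. A system $(X_{n,i})_{1\le n\le N_i,\,1\le i\le C}$ of random variables, $X_{n,i}$ with values in $\mathcal{S}_i$, is multi-exchangeable if $\mathcal{L}\big((X_{\sigma_i(n),i})_{1\le n\le N_i,1\le i\le C}\big)=\mathcal{L}\big((X_{n,i})_{1\le n\le N_i,1\le i\le C}\big)$ for all $\sigma_i\in\Sigma(N_i)$, $1\le i\le C$. In particular each class $(X_{n,i})_{n}$ is exchangeable; if $N_i=\infty$, by de Finetti's theorem the limit $\Lambda_i^\infty=\lim_{N\to\infty}\frac1N\sum_{n=1}^N\delta_{X_{n,i}}$ exists a.s. in the weak topology of $\mathcal{P}(\mathcal{S}_i)$ (the directing measure). The measure vector is $(\Lambda_i^{N_i})_{1\le i\le C}$ with values in $\mathcal{P}(\mathcal{S}_1)\times\cdots\times\mathcal{P}(\mathcal{S}_C)$, where $\Lambda_i^{N_i}=\frac1{N_i}\sum_{n=1}^{N_i}\delta_{X_{n,i}}$ (empirical measure) if $N_i<\infty$ and $\Lambda_i^{N_i}=\Lambda_i^\infty$ (directing measure) if $N_i=\infty$. For $1\le k\le N$ finite, $\lambda^{N,k}(x_1,\dots,x_N)=\frac1{(N)_k}\sum_{1\le n_1,\dots,n_k\le N\text{ distinct}}\delta_{(x_{n_1},\dots,x_{n_k})}\in\mathcal{P}(\mathcal{S}^k)$ with $(N)_k=N(N-1)\cdots(N-k+1)$;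 it depends only on $\frac1N\sum_{n=1}^N\delta_{x_n}$. Spaces of probability measures carry the weak topology. *)

(* Defs.v *)
From HB Require Import structures.
From mathcomp Require Import all_boot all_order all_algebra all_fingroup.
From mathcomp Require Import all_classical all_reals all_analysis.
From mathcomp Require Import measurable_realfun.

Set Implicit Arguments.
Unset Strict Implicit.
Unset Printing Implicit Defensive.

Import Order.TTheory GRing.Theory Num.Theory.
Import numFieldTopology.Exports numFieldNormedType.Exports.
Local Open Scope classical_set_scope.
Local Open Scope ring_scope.

(* A Polish space, presented with a complete metric compatible with its
   topology: complete (pseudo)metric space, Hausdorff (so the pseudometric
   is a metric), and separable (has a countable dense subset). *)
Definition polish (R : realType) (T : completePseudoMetricType R) : Prop :=
  hausdorff_space T /\ exists D : set T, countable D /\ dense D.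

Definition borel (T : ptopologicalType) := g_sigma_algebraType (@open T).

Definition Prob (T : ptopologicalType) (R : realType) :=
  probability (borel T) R.

Definition bcont (T : topologicalType) (R : realType) (f : T -> R) : Prop :=
  continuous f /\ exists M : R, forall x, `|f x| <= M.

Definition integ (T : ptopologicalType) (R : realType) (mu : Prob T R)
  (f : T -> R) : R := Rintegral mu setT (f : borel T -> R).

(* Open sets of the weak topology on P(T): the topology generated by the maps
   mu |-> \int f dmu, f bounded continuous. *)
Definition weak_open (T : ptopologicalType) (R : realType) :
    set (set (Prob T R)) :=
  [set U | forall mu, U mu -> exists (k : nat) (fs : 'I_k -> T -> R) (e : R),
     [/\ 0 < e, (forall j, bcont (fs j)) &
         [set nu | forall j, `|integ nu (fs j) - integ mu (fs j)| < e] `<=` U]].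

Arguments weak_open : clear implicits.

Definition weak_borel (T : ptopologicalType) (R : realType) :
    set (set (Prob T R)) := <<s weak_open T R >>.
Arguments weak_borel : clear implicits.

(* {1,...,N} (encoded 0-based as 'I_N) if N < oo, {1,2,...} (encoded as nat)
   if N = oo (encoded as None). *)
Definition Idx (o : option nat) : Type :=
  match o with Some k => 'I_k | None => nat end.

HB.instance Definition _ (U : Type) (T : U -> ptopologicalType) :=
  Pointed.copy (prod_topology T) (forall x : U, T x).

Definition seq_space (T : ptopologicalType) (o : option nat) : ptopologicalType :=
  prod_topology (fun _ : Idx o => T).

Definition system_space (C : nat) (S : 'I_C -> ptopologicalType)
  (N : 'I_C -> option nat) : ptopologicalType :=
  prod_topology (fun i => seq_space (S i) (N i)).

Definition finperm (I : Type) (s : I -> I) : Prop :=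
  bijective s /\ finite_set [set x | s x <> x].

Definition multi_exchangeable (R : realType) d (Omega : measurableType d)
  (P : probability Omega R) (C : nat) (S : 'I_C -> ptopologicalType)
  (N : 'I_C -> option nat) (X : forall i, Idx (N i) -> Omega -> S i) : Prop :=
  forall sg : forall i, Idx (N i) -> Idx (N i), (forall i, finperm (sg i)) ->
  forall A : set (borel (system_space S N)), measurable A ->
    P [set w | A (fun i n => X i (sg i n) w)] = P [set w | A (fun i n => X i n w)].

Local Open Scope ereal_scope.

Definition empirical (T : ptopologicalType) (R : realType) (k : nat)
  (x : 'I_k -> T) (A : set (borel T)) : \bar R :=
  ((k%:R)^-1)%:E * \sum_(n < k) \d_(x n : borel T) A.

Definition lambdaNk (T : ptopologicalType) (R : realType) (N k : nat)
  (x : 'I_N -> T) (A : set (borel (seq_space T (Some k)))) : \bar R :=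
  (((N ^_ k)%:R)^-1)%:E *
  \sum_(f : {ffun 'I_k -> 'I_N} | injectiveb f)
     \d_((fun j : 'I_k => x (f j)) : borel (seq_space T (Some k))) A.

Definition iid_product (T : ptopologicalType) (R : realType) (lam : Prob T R)
  (q : Prob (seq_space T None) R) : Prop :=
  forall (m : nat) (A : 'I_m -> set (borel T)), (forall j, measurable (A j)) ->
    q [set y : borel (seq_space T None) | forall j : 'I_m, A j (y (nat_of_ord j))]
    = \prod_(j < m) lam (A j).

Definition class_law (T : ptopologicalType) (R : realType) (o : option nat) :
    (Idx o -> T) -> Prob T R -> Prob (seq_space T o) R -> Prop :=
  match o return (Idx o -> T) -> Prob T R -> Prob (seq_space T o) R -> Prop with
  | Some k => fun x _ q =>
      forall A : set (borel (seq_space T (Some k))), measurable A ->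
        q A = @lambdaNk T R k k x A
  | None => fun _ lam q => iid_product lam q
  end.

(* Lambda_i^{N_i}: the empirical measure if N_i < oo; the directing measure
   (a.s. weak limit of the empirical measures, taken as a random variable
   with values in P(S_i) with its weak Borel sigma-algebra) if N_i = oo. *)
Definition measure_vector_comp (R : realType) d (Omega : measurableType d)
  (P : probability Omega R) (T : ptopologicalType) (o : option nat) :
    (Idx o -> Omega -> T) -> (Omega -> Prob T R) -> Prop :=
  match o return (Idx o -> Omega -> T) -> (Omega -> Prob T R) -> Prop with
  | Some k => fun x lam => forall w (A : set (borel T)), measurable A ->
      lam w A = @empirical T R k (fun n => x n w) A
  | None => fun x lam =>
      (forall B, weak_borel T R B -> measurable (lam @^-1` B)) /\
      {ae P, forall w, forall f : T -> R, bcont f ->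
         (fun M : nat => ((M.+1)%:R^-1 * \sum_(n < M.+1) f (x n w))%R)
           @ \oo --> integ (lam w) f}
  end.

Definition sigma_gen d (Omega : measurableType d) (R : realType) (C : nat)
  (S : 'I_C -> ptopologicalType) (Lam : forall i, Omega -> Prob (S i) R) :
    set (set Omega) :=
  <<s \bigcup_(i in [set: 'I_C]) [set Lam i @^-1` B | B in weak_borel (S i) R] >>.

Definition is_product_measure (R : realType) (C : nat)
  (T : 'I_C -> ptopologicalType) (q : forall i, Prob (T i) R)
  (K : Prob (prod_topology T) R) : Prop :=
  forall A : forall i, set (borel (T i)), (forall i, measurable (A i)) ->
    K [set y : borel (prod_topology T) | forall i, A i (y i)]
    = \prod_(i < C) q i (A i).

Definition cond_law (R : realType) d (Omega : measurableType d)
  (P : probability Omega R) (G : set (set Omega)) (T : ptopologicalType)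
  (Y : Omega -> T) (K : Omega -> Prob T R) : Prop :=
  forall A : set (borel T), measurable A ->
    (forall B : set (\bar R), measurable B -> G ((fun w => K w A) @^-1` B)) /\
    (forall E, G E -> P (E `&` Y @^-1` A) = \int[P]_(w in E) K w A).

(* Main.v *)
(* Up to null sets, every event of the sigma-algebra of the measure vector is an
   event of the system that is invariant under finite permutations within each
   class, because empirical averages are.  Multi-exchangeability therefore says
   that, on such an event, the law of the system is not changed by permuting
   classes separately.  Averaging over all permutations of a finite class turns
   its configuration into a sample without replacement from the empirical
   measure.  In an infinite class, exchanging the coordinate X_l with X_n and
   averaging over n replaces f(X_l) by the integral of f with respect to the
   directing measure, for bounded continuous f and then for indicators.  Treating
   the classes one after the other gives the product form.  Measurability of the
   kernels rests on the fact that over a second countable space the weak Borel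
   sigma-algebra is generated by the evaluations at open sets. *)
Require Import Defs.
From HB Require Import structures.
From mathcomp Require Import all_boot all_order all_algebra all_fingroup.
From mathcomp Require Import all_classical all_reals all_analysis.
From mathcomp Require Import measurable_realfun lra.

Set Implicit Arguments.
Unset Strict Implicit.
Unset Printing Implicit Defensive.

Import Order.TTheory GRing.Theory Num.Theory.
Import numFieldTopology.Exports numFieldNormedType.Exports.
Local Open Scope classical_set_scope.
Local Open Scope ring_scope.

(** The kernels must be functions of a measure alone, defined on all of [Prob (S i) R], whereas the
    sampling law is written through a configuration. A configuration is chosen, without any
    measurability, for each empirical measure; measurability comes back because the mass of a
    rectangle depends only on finitely many masses of the empirical measure, provided that the set
    of empirical measures is itself weakly Borel. This last point is settled by coding each point by
    the basic open sets that contain it: a measure is empirical for [k] points exactly when it gives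
    countably many cells masses that are multiples of [1/k]. A directing measure is only an almost
    sure limit, so the events of the measure vector are invariant up to null sets; each one is
    exchanged for an exactly invariant event before the permutations act. Independence comes from
    treating one coordinate or class in the presence of an event that records the ones not yet
    converted into kernel factors. Converted factors are measurable for the conditioning
    sigma-algebra and can be pulled out. *)

Lemma measurable_fun_gen d (aT : measurableType d) (T : pointedType)
    (G : set (set T)) (f : aT -> T) :
  (forall B, G B -> measurable (f @^-1` B)) ->
  measurable_fun [set: aT] (f : aT -> g_sigma_algebraType G).
Proof.
move=> mf; apply: (@measurability _ _ aT (g_sigma_algebraType G) setT f G erefl).
by move=> _ [B GB <-]; rewrite setTI; exact: mf.
Qed.

(** * Products of countably many probability measures *)

Section product_measure.
Local Open Scope ereal_scope.
Context (R : realType) (I : countType) (d : I -> measure_display)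
  (T : forall i, measurableType (d i)) (mu : forall i, probability (T i) R).

Let Om := forall i, T i.

Definition cylinders : set (set Om) :=
  [set B | exists i (A : set (T i)), measurable A /\ B = [set x | A (x i)]].

Definition prodM : measurableType cylinders.-sigma := g_sigma_algebraType cylinders.

Lemma measurable_dfwith i :
  measurable_fun [set: prodM * T i] (fun p => dfwith p.1 i p.2 : prodM).
Proof.
apply: measurable_fun_gen => _ [j [A [mA ->]]].
case: (eqVneq i j) => [ij|ij].
  subst j; rewrite [X in measurable X](_ : _ = snd @^-1` A).
    by rewrite -[X in measurable X]setTI; exact: measurable_snd.
  by apply/seteqP; split => -[x t] /=; rewrite dfwithin.
rewrite [X in measurable X](_ : _ = fst @^-1` [set x : prodM | A (x j)]).
  rewrite -[X in measurable X]setTI; apply: measurable_fst => //.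
  by apply: sub_sigma_algebra; exists j, A.
by apply/seteqP; split => -[x t] /=; rewrite dfwithout.
Qed.

Definition integ_coord i (f : Om -> \bar R) (x : Om) : \bar R :=
  \int[mu i]_t f (dfwith x i t).

(* Coordinates are integrated out in the order of their codes. *)
Definition stepi (k : nat) (f : Om -> \bar R) : Om -> \bar R :=
  if pickle_inv k is Some i then integ_coord i f else f.

(** The integral over the coordinate of code [k] is the outermost one, which is what lets
    [tail_cvg0] fix the coordinates one after the other. *)
Fixpoint steps (m k : nat) (f : Om -> \bar R) : Om -> \bar R :=
  if m is m'.+1 then stepi k (steps m' k.+1 f) else f.

Definition depends_below (n : nat) {U : Type} (f : Om -> U) :=
  forall x y, (forall i, (pickle i < n)%N -> x i = y i) -> f x = f y.

Definition ge0_mfun (f : Om -> \bar R) :=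
  measurable_fun [set: prodM] f /\ forall x, 0 <= f x.

Lemma ge0_mfun_sec f i x : ge0_mfun f -> measurable_fun [set: T i] (fun t => f (dfwith x i t)).
Proof.
move=> [mf _]; apply: (@measurableT_comp _ _ _ (T i) prodM _ f setT (dfwith x i)) => //.
have h := measurableT_comp (@measurable_dfwith i) (pair1_measurable (x : prodM)).
exact: h.
Qed.

Lemma ge0_mfun_stepi k f : ge0_mfun f -> ge0_mfun (stepi k f).
Proof.
rewrite /stepi; case: pickle_inv => [i|//] hf; split => [|x]; last first.
  by apply: integral_ge0 => t _; exact: hf.2.
apply: (@measurable_fun_fubini_tonelli_F _ _ _ _ _ (mu i)
  (fun p : prodM * T i => f (dfwith p.1 i p.2))) => [|p].
  have h := measurableT_comp hf.1 (@measurable_dfwith i); exact: h.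
exact: hf.2.
Qed.

Lemma ge0_mfun_steps m k f : ge0_mfun f -> ge0_mfun (steps m k f).
Proof. by elim: m k => //= m ih k hf; apply/ge0_mfun_stepi/ih. Qed.

Lemma stepiD k f g : ge0_mfun f -> ge0_mfun g -> stepi k (f \+ g) = stepi k f \+ stepi k g.
Proof.
move=> hf hg; rewrite /stepi; case: pickle_inv => [i|//].
apply/funext => x; rewrite /integ_coord /= ge0_integralD //.
- by move=> t _; exact: hf.2.
- exact: ge0_mfun_sec.
- by move=> t _; exact: hg.2.
- exact: ge0_mfun_sec.
Qed.

Lemma stepsD m k f g : ge0_mfun f -> ge0_mfun g ->
  steps m k (f \+ g) = steps m k f \+ steps m k g.
Proof.
move=> hf hg; elim: m k => //= m ih k.
by rewrite ih stepiD//; exact: ge0_mfun_steps.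
Qed.

Lemma le_stepi k f g : ge0_mfun f -> ge0_mfun g -> (forall x, f x <= g x) ->
  forall x, stepi k f x <= stepi k g x.
Proof.
move=> hf hg fg x; rewrite /stepi; case: pickle_inv => [i|//].
apply: ge0_le_integral => //.
- by move=> t _; exact: hf.2.
- exact: ge0_mfun_sec.
- exact: ge0_mfun_sec.
Qed.

Lemma le_steps m k f g : ge0_mfun f -> ge0_mfun g -> (forall x, f x <= g x) ->
  forall x, steps m k f x <= steps m k g x.
Proof.
by move=> hf hg fg; elim: m k => //= m ih k; apply: le_stepi => //; exact: ge0_mfun_steps.
Qed.

Lemma pickle_inv_some (k : nat) (i : I) : pickle_inv k = Some i -> pickle i = k.
Proof. by move=> ik; have := @pickle_invK I k; rewrite ik. Qed.

Lemma steps_dep m k (A : set Om) : depends_below k A ->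
  steps m k (fun x => (\1_A x)%:E) = fun x => (\1_A x)%:E.
Proof.
elim: m k => //= m ih k dA.
rewrite ih; last first.
  by move=> x y xy; apply: dA => i ik; apply: xy; exact: ltnW.
rewrite /stepi; case ik : (pickle_inv k) => [i|//]; apply/funext => x.
rewrite /integ_coord (eq_integral (fun=> (\1_A x)%:E)).
  by rewrite integral_cst// [X in _ * X]probability_setT mule1.
move=> t _; rewrite !indicE; congr (_%:R%:E).
have -> // : (dfwith x i t \in A) = (x \in A).
have AA : A (dfwith x i t) = A x.
  apply: dA => j jk; rewrite dfwithout//.
  apply/eqP => ij; subst j; by rewrite (pickle_inv_some ik) ltnn in jk.
by apply/idP/idP; rewrite !inE AA.
Qed.

Lemma steps_add (m p k : nat) f : steps (m + p) k f = steps m k (steps p (k + m) f).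
Proof.
elim: m k => [|m ih] k /=; first by rewrite addn0.
by rewrite ih addSnnS.
Qed.

Definition cyl_alg : set (set Om) :=
  [set A | (cylinders.-sigma).-measurable (A : set prodM) /\ exists n, depends_below n A].

Lemma depends_belowW {U} (n m : nat) (f : Om -> U) : (n <= m)%N -> depends_below n f ->
    depends_below m f.
Proof. by move=> nm h x y xy; apply: h => i ii; apply: xy; exact: leq_trans nm. Qed.

Lemma cyl_alg0 : cyl_alg set0.
Proof. by split; [exact: measurable0|exists 0%N]. Qed.

Lemma cyl_algU : setU_closed cyl_alg.
Proof.
move=> A B [mA [n nA]] [mB [m mB']]; split; first exact: measurableU.
exists (maxn n m) => x y xy; rewrite /setU /mkset.
by rewrite (depends_belowW (leq_maxl n m) nA xy) (depends_belowW (leq_maxr n m) mB' xy).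
Qed.

Lemma cyl_algC : setC_closed cyl_alg.
Proof.
move=> A [mA [n nA]]; split; first exact: measurableC.
by exists n => x y xy; rewrite /setC /mkset (nA _ _ xy).
Qed.

(** Sealed by [Qed]: the algebra of cylinders gets a display of its own, apart from that of the
    sigma-algebra on the same carrier. *)
Lemma cylinder_display : measure_display. Proof. exact: default_measure_display. Qed.

Definition cylinder_algebraType : Type := Om.
HB.instance Definition _ := Pointed.on cylinder_algebraType.
HB.instance Definition _ := @isAlgebraOfSets.Build cylinder_display cylinder_algebraType cyl_alg
  cyl_alg0 cyl_algU cyl_algC.

Let ind (A : set Om) : Om -> \bar R := fun x => (\1_A x)%:E.

Lemma ge0_mfun_ind A : cyl_alg A -> ge0_mfun (ind A).
Proof.
move=> [mA _]; split => [|x]; last by rewrite lee_fin.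
by apply/measurable_EFinP; exact: (@measurable_indic _ prodM R setT A).
Qed.

(* The probability of [A] given the coordinates of code less than [k]; the
   sequence is eventually constant when [A] depends on finitely many coordinates. *)
Definition tail (k : nat) (A : set Om) (x : Om) := limn (fun m => steps m k (ind A) x).

Lemma tailE (k m : nat) A : depends_below (k + m) A -> tail k A = steps m k (ind A).
Proof.
move=> dA; apply/funext => x; apply: lim_near_cst => //.
near=> p; have mp : (m <= p)%N by near: p; exists m.
by rewrite -(subnKC mp) steps_add steps_dep.
Unshelve. all: by end_near. Qed.

Lemma tail_stepi k A : cyl_alg A -> tail k A = stepi k (tail k.+1 A).
Proof.
move=> [_ [n dA]].
rewrite (@tailE k n.+1); last by apply: depends_belowW dA; rewrite addnS leqW// leq_addl.
by rewrite (@tailE k.+1 n)//; apply: depends_belowW dA; rewrite leq_addl.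
Qed.

Lemma ge0_mfun_tail k A : cyl_alg A -> ge0_mfun (tail k A).
Proof.
move=> cA; have [_ [n dA]] := cA.
rewrite (@tailE k n); first exact/ge0_mfun_steps/ge0_mfun_ind.
by apply: depends_belowW dA; rewrite leq_addl.
Qed.

Lemma le_tail k A B : cyl_alg A -> cyl_alg B -> A `<=` B -> forall x, tail k A x <= tail k B x.
Proof.
move=> cA cB AB; have [_ [n dA]] := cA; have [_ [m dB]] := cB.
rewrite (@tailE k (maxn n m)); last first.
  by apply: depends_belowW dA; rewrite (leq_trans (leq_maxl n m))// leq_addl.
rewrite (@tailE k (maxn n m)); last first.
  by apply: depends_belowW dB; rewrite (leq_trans (leq_maxr n m))// leq_addl.
apply: le_steps; [exact: ge0_mfun_ind..|] => x; rewrite lee_fin.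
by rewrite !indicE; case: (boolP (x \in A)) => //; rewrite ?ler0n// !inE => /AB/mem_set ->.
Qed.

Lemma tail_le1 k A : cyl_alg A -> forall x, tail k A x <= 1.
Proof.
move=> cA x; have cT : cyl_alg setT by split => //; exists 0%N.
apply: le_trans (le_tail k cA cT (@subsetT _ _) x) _.
rewrite (@tailE k 0%N)//.
by rewrite /ind /= indicT.
Qed.

Lemma tail0 k x : tail k set0 x = 0.
Proof. by rewrite (@tailE k 0%N)// /= /ind indic0. Qed.

Lemma tailU k A B : cyl_alg A -> cyl_alg B -> A `&` B = set0 ->
  tail k (A `|` B) = tail k A \+ tail k B.
Proof.
move=> cA cB AB; have [_ [n dA]] := cA; have [_ [m dB]] := cB.
have dAk : depends_below (k + maxn n m) A.
  by apply: depends_belowW dA; rewrite (leq_trans (leq_maxl n m))// leq_addl.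
have dBk : depends_below (k + maxn n m) B.
  by apply: depends_belowW dB; rewrite (leq_trans (leq_maxr n m))// leq_addl.
rewrite (tailE dAk) (tailE dBk) (@tailE k (maxn n m)); last first.
  by move=> x y xy; rewrite /setU /mkset (dAk _ _ xy) (dBk _ _ xy).
rewrite -stepsD; [|exact: ge0_mfun_ind..].
congr steps; apply/funext => x; rewrite /ind /= -EFinD.
congr EFin; rewrite !indicE in_setU.
have [xA|xA] := boolP (x \in A); last by rewrite add0r.
rewrite [x \in B](_ : _ = false) ?addr0//; apply/negbTE/negP => xB.
have : (A `&` B) x by split; exact/set_mem.
by rewrite AB.
Qed.

(* If the integrals do not tend to [0], a point is built one coordinate at a time
   along which the tail integrals do not either; it lies in every [F n]. *)
Lemma tail_cvg0 (F : nat -> set Om) : (forall n, cyl_alg (F n)) ->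
  (forall n m, (n <= m)%N -> F m `<=` F n) -> \bigcap_n F n = set0 ->
  forall x, tail 0%N (F n) x @[n --> \oo] --> 0.
Proof.
move=> cF ndF F0 x0; apply: contrapT => nx0.
pose bad (k : nat) x := ~ (tail k (F n) x @[n --> \oo] --> 0).
have next (k : nat) x : bad k x -> exists y, bad k.+1 y /\
    (forall i, (pickle i < k)%N -> y i = x i).
  move=> bx; case ik : (pickle_inv k) => [i|]; last first.
    exists x; split => //; move: bx; rewrite /bad.
    by under eq_fun do rewrite tail_stepi// /stepi ik.
  (* If the tail integrals tended to [0] for every value [t] of the new coordinate, dominated
     convergence with bound [1] would make their integral tend to [0]. *)
  apply: contrapT => /forallNP nex; apply: bx.
  under eq_fun do rewrite tail_stepi// /stepi ik.
  have [] := @dominated_convergence _ _ _ (mu i) _ (@measurableT _ (T i))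
    (fun n t => tail k.+1 (F n) (dfwith x i t)) (cst 0) (cst 1).
  - by move=> n; exact/ge0_mfun_sec/ge0_mfun_tail.
  - exact: measurable_cst.
  - apply: aeW => t _; have := nex (dfwith x i t).
    move=> /not_andP[/contrapT//|]; case=> j jk.
    rewrite dfwithout//; apply/eqP => ij; subst j; by rewrite (pickle_inv_some ik) ltnn in jk.
  - exact: finite_measure_integrable_cst.
  - apply: aeW => t n _; rewrite gee0_abs; first exact: tail_le1.
    exact: (ge0_mfun_tail k.+1 (cF n)).2.
  by move=> _ _; rewrite integral0.
have [nx nxP] : exists nx : nat -> Om -> Om, forall k x, bad k x ->
    bad k.+1 (nx k x) /\ (forall i, (pickle i < k)%N -> nx k x i = x i).
  have /choice[f fP] : forall kx : nat * Om, exists y, bad kx.1 kx.2 ->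
      bad kx.1.+1 y /\ (forall i, (pickle i < kx.1)%N -> y i = kx.2 i).
    move=> [k x]; have [bx|bx] := pselect (bad k x); last by exists x.
    by have [y hy] := next _ _ bx; exists y.
  by exists (fun k x => f (k, x)) => k x; exact: (fP (k, x)).
pose path := fix path k := if k is k'.+1 then nx k' (path k') else x0.
have pbad k : bad k (path k).
  by elim: k => [//|k ih] /=; exact: (nxP _ _ ih).1.
have pstab (k m : nat) i : (pickle i < k)%N -> path (k + m)%N i = path k i.
  move=> ik; elim: m => [|m ih]; first by rewrite addn0.
  rewrite addnS /= (nxP _ _ (pbad (k + m)%N)).2//.
  by rewrite (leq_trans ik)// leq_addr.
(* The path is frozen at coordinate [i] from stage [(pickle i).+1] on, so this diagonal point agrees
   with stage [k] on all codes below [k]. *)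
pose x : Om := fun i => path (pickle i).+1 i.
have xE (k : nat) i : (pickle i < k)%N -> x i = path k i.
  by move=> ik; rewrite /x -(subnKC ik) pstab.
suff : (\bigcap_n F n) x by rewrite F0.
move=> n _; have [_ [N dN]] := cF n.
have -> : F n x = F n (path N) by apply: dN => i iN; exact: xE.
apply: contrapT => nF; apply: (pbad N).
(* [F n] depends only on codes below [N], so at stage [N] its tail integral is its indicator; those
   of the later [F m] are squeezed between [0] and it. *)
have z : tail N (F n) (path N) = 0.
  by rewrite (@tailE N 0%N); rewrite ?addn0// /= /ind indicE memNset.
apply: cvg_near_cst; near=> m.
have nm : (n <= m)%N by near: m; exists n.
apply/eqP; rewrite eq_le (ge0_mfun_tail _ _).2// andbT -z.
by apply: le_tail => //; exact: ndF.
Unshelve. all: by end_near. Qed.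

(** All coordinates are integrated out in [tail 0], which makes the base [point] immaterial; the
    value [0] off the algebra keeps the function nonnegative on every set. *)
Definition cyl_content (A : set cylinder_algebraType) : \bar R :=
  if `[< cyl_alg A >] then tail 0%N A point else 0.

Lemma cyl_contentE A : cyl_alg A -> cyl_content A = tail 0%N A point.
Proof. by move=> cA; rewrite /cyl_content; case: asboolP. Qed.

Let cyl_content0 : cyl_content set0 = 0.
Proof. by rewrite cyl_contentE ?tail0//; exact: cyl_alg0. Qed.

Let cyl_content_ge0 A : 0 <= cyl_content A.
Proof.
by rewrite /cyl_content; case: asboolP => // cA; exact: (ge0_mfun_tail _ cA).2.
Qed.

Lemma cyl_contentU (A B : set cylinder_algebraType) : cyl_alg A -> cyl_alg B -> A `&` B = set0 ->
  cyl_content (A `|` B) = cyl_content A + cyl_content B.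
Proof.
move=> cA cB AB; rewrite !cyl_contentE ?tailU//.
exact: cyl_algU.
Qed.

Let cyl_alg_bigU (F : nat -> set cylinder_algebraType) n : (forall i, cyl_alg (F i)) ->
  cyl_alg (\big[setU/set0]_(i < n) F i).
Proof.
by move=> cF; elim/big_ind: _ => //; [exact: cyl_alg0|exact: cyl_algU].
Qed.

(** Continuity at the empty set gives countable additivity: the remainders [G n] of a disjoint union
    decrease to the empty set, and [tail_cvg0] sends their content to [0]. *)
Let cyl_content_sigma_additive : semi_sigma_additive cyl_content.
Proof.
move=> F cF tF cUF.
pose G n := \bigcup_i F i `\` \big[setU/set0]_(i < n) F i.
have cG n : cylinder_display.-measurable (G n : set cylinder_algebraType).
  by apply: measurableD => //; exact: cyl_alg_bigU.
have E n : cyl_content (\big[setU/set0]_(i < n) F i) = \sum_(0 <= i < n) cyl_content (F i).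
  elim: n => [|n ih]; first by rewrite big_ord0 big_nil cyl_content0.
  rewrite big_ord_recr big_nat_recr//= cyl_contentU ?ih//; [exact: cyl_alg_bigU|exact: cF|].
  apply/seteqP; split => // x []; rewrite -bigcup_mkord => -[k /= kn Fkx Fnx].
  have kn' : k = n by apply: tF => //; exists x.
  by rewrite kn' ltnn in kn.
have GE n : cyl_content (\bigcup_i F i) =
    \sum_(0 <= i < n) cyl_content (F i) + cyl_content (G n).
  rewrite -E -cyl_contentU; last 3 first.
  - exact: cyl_alg_bigU.
  - exact: cG.
  - by rewrite /G setDIK.
  rewrite /G setDUK//; exact: bigsetU_bigcup.
have G0 : cyl_content (G n) @[n --> \oo] --> 0.
  rewrite [X in X @ _ --> _](_ : _ = fun n => tail 0%N (G n) point); last first.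
    by apply/funext => n; rewrite cyl_contentE//; exact: cG.
  apply: tail_cvg0 => // [n m nm|].
    by apply: setDS; exact: subset_bigsetU.
  apply/seteqP; split => // x Gx.
  have [[k _ Fk] _] := Gx 0%N Logic.I.
  have [_] := Gx k.+1 Logic.I; apply; rewrite big_ord_recr /=; by right.
have Gfin n : cyl_content (G n) \is a fin_num.
  rewrite ge0_fin_numE// (le_lt_trans _ (ltry 1))// cyl_contentE; first by apply: tail_le1;
      exact: cG.
  exact: cG.
rewrite [X in X @ _ --> _](_ : _ = fun n => cyl_content (\bigcup_i F i) - cyl_content (G n)).
  rewrite -[X in _ --> X]sube0; apply: cvgeB => //; last exact: cvg_cst.
  by rewrite fin_num_adde_defl.
by apply/funext => n; rewrite (GE n) addeK.
Qed.

HB.instance Definition _ := isMeasure.Build _ cylinder_algebraType R cyl_content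
  cyl_content0 cyl_content_ge0 cyl_content_sigma_additive.

Lemma cyl_alg_sigma (A : set Om) : <<s cylinders >> A -> <<s (@measurable _
    cylinder_algebraType) >> A.
Proof.
apply: sub_sigma_algebra2 => _ [i [B [mB ->]]]; split; first by apply: sub_sigma_algebra; exists
    i, B.
exists (pickle i).+1 => x y xy /=; by rewrite xy.
Qed.

Definition prod_measure (A : set prodM) : \bar R :=
  measure_extension cyl_content A.

Let prod_measure0 : prod_measure set0 = 0.
Proof. exact: measure0. Qed.

Let prod_measure_ge0 A : 0 <= prod_measure A.
Proof. exact: measure_ge0. Qed.

Let prod_measure_sigma_additive : semi_sigma_additive prod_measure.
Proof.
move=> F mF tF mUF; apply: measure_semi_sigma_additive => //.
- by move=> n; apply: cyl_alg_sigma; exact: mF.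
- exact: cyl_alg_sigma.
Qed.

HB.instance Definition _ := isMeasure.Build _ prodM R prod_measure
  prod_measure0 prod_measure_ge0 prod_measure_sigma_additive.

Lemma prod_measure_cyl (A : set Om) : cyl_alg A -> prod_measure A = tail 0%N A point.
Proof.
move=> cA; rewrite -cyl_contentE// /prod_measure /measure_extension.
by rewrite measurable_mu_extE.
Qed.

Let prod_measureT : prod_measure setT = 1.
Proof.
rewrite prod_measure_cyl; last by split => //; exists 0%N.
by rewrite (@tailE 0%N 0%N)// /= /ind indicT.
Qed.

HB.instance Definition _ := Measure_isProbability.Build _ _ _ prod_measure prod_measureT.

Definition rect (s : seq I) (A : forall i, set (T i)) : set Om :=
  [set x | forall i, i \in s -> A i (x i)].

(** The rectangle half-way through the integration: sides of code below [k] are still indicators,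
    the others have become masses. *)
Let recf k (s : seq I) (A : forall i, set (T i)) (x : Om) : \bar R :=
  \prod_(i <- s) (if (pickle i < k)%N then (\1_(A i) (x i))%:E else mu i (A i)).

Lemma measurable_rect s (A : forall i, set (T i)) : (forall i, measurable (A i)) ->
  (cylinders.-sigma).-measurable (rect s A : set prodM).
Proof.
move=> mA; elim: s => [|i s ih].
  by rewrite [X in measurable X](_ : _ = setT)//; apply/seteqP; split.
rewrite [X in measurable X](_ : _ = [set x | A i (x i)] `&` rect s A).
  by apply: measurableI => //; apply: sub_sigma_algebra; exists i, (A i).
apply/seteqP; split => x /=.
  move=> h; split; first by apply: h; rewrite mem_head.
  by move=> j js; apply: h; rewrite inE js orbT.
by move=> [h1 h2] j; rewrite inE => /orP[/eqP->|/h2].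
Qed.

Lemma cyl_alg_rect s A : (forall i, measurable (A i)) -> cyl_alg (rect s A).
Proof.
move=> mA; split; first exact: measurable_rect.
exists (\max_(i <- s) (pickle i).+1) => x y xy.
apply/propext; split => h i si; have := h i si; rewrite xy//.
  exact: (@leq_bigmax_seq _ s xpredT (fun i => (pickle i).+1) i si isT).
exact: (@leq_bigmax_seq _ s xpredT (fun i => (pickle i).+1) i si isT).
Qed.

(** Since [s] has no repetition, at most one factor involves the coordinate of code [k]; the others
    form a finite constant that leaves the integral. *)
Lemma stepi_recf k s A : uniq s -> (forall i, measurable (A i)) ->
  stepi k (recf k.+1 s A) = recf k s A.
Proof.
move=> us mA; rewrite /stepi; case ik : (pickle_inv k) => [i|]; last first.
  apply/funext => x; apply: eq_bigr => i _; rewrite ltnS leq_eqVlt.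
  case: eqVneq => //= ik'; have := @pickleK_inv I i.
  by rewrite ik' ik.
have pik := pickle_inv_some ik.
have E j : j != i -> (pickle j < k.+1)%N = (pickle j < k)%N.
  move=> ji; rewrite ltnS leq_eqVlt; case: eqVneq => //= jk.
  have := @pickleK_inv I j; rewrite jk ik => -[ij].
  by rewrite ij eqxx in ji.
apply/funext => x; rewrite /integ_coord.
have [si|si] := boolP (i \in s); last first.
  rewrite (eq_integral (cst (recf k s A x))); last first.
    move=> t _; rewrite /recf /= big_seq [RHS]big_seq; apply: eq_bigr => j js.
    have ij : j != i by apply: contraNneq si => <-.
    by rewrite E// dfwithout// eq_sym.
  have f : recf k s A x \is a fin_num.
    apply: prode_fin_num => j _; case: ifP => // _; exact: fin_num_measure.
  by rewrite -(fineK f) integral_cst// [X in _ * X]probability_setT mule1.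
pose c := \prod_(j <- rem i s) (if (pickle j < k)%N then (\1_(A j) (x j))%:E else mu j (A j)).
have f : c \is a fin_num.
  apply: prode_fin_num => j _; case: ifP => // _; exact: fin_num_measure.
rewrite (eq_integral (fun t => c * (\1_(A i) t)%:E)); last first.
  move=> t _; rewrite /recf (perm_big _ (perm_to_rem si)) big_cons /= pik ltnSn dfwithin muleC.
  congr (_ * _); rewrite /c !big_seq; apply: eq_bigr => j.
  rewrite mem_rem_uniq// inE => /andP[ji _].
  by rewrite E// dfwithout// eq_sym.
have c0 : 0 <= c.
  apply: prode_ge0 => j _; case: ifP => // _; by rewrite lee_fin.
rewrite ge0_integralZl//; last by apply/measurable_EFinP; exact: measurable_indic.
rewrite integral_indic// setIT /recf (perm_big _ (perm_to_rem si)) big_cons /= pik ltnn muleC.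
by [].
Qed.

Lemma prod_measure_rect s (A : forall i, set (T i)) :
  uniq s -> (forall i, measurable (A i)) ->
  prod_measure (rect s A) = \prod_(i <- s) mu i (A i).
Proof.
move=> us mA; have cA := cyl_alg_rect s mA; rewrite prod_measure_cyl//.
have [_ [n0 dA0]] := cA.
pose n := maxn n0 (\max_(i <- s) (pickle i).+1).
have dA : depends_below n (rect s A) by apply: depends_belowW dA0; exact: leq_maxl.
rewrite (@tailE 0%N n)//.
have -> : ind (rect s A) = recf n s A.
  apply/funext => x; rewrite /ind /recf.
  rewrite big_seq (eq_bigr (fun i => (\1_(A i) (x i))%:E)); last first.
    move=> i si; rewrite (leq_trans (@leq_bigmax_seq _ s xpredT (fun i => (pickle i).+1) i si
        isT))//.
    exact: leq_maxr.
  rewrite -big_seq; elim: (s) => [|i s' ih].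
    by rewrite big_nil indicE mem_set.
  have E : (x \in rect (i :: s') A) = (x i \in A i) && (x \in rect s' A).
    apply/idP/idP.
      move=> /set_mem h; apply/andP; split; apply/mem_set.
        by apply: h; rewrite mem_head.
      by move=> j js; apply: h; rewrite inE js orbT.
    move=> /andP[/set_mem Ai /set_mem h]; apply/mem_set => j.
    by rewrite inE => /orP[/eqP->|/h].
  by rewrite big_cons -ih -EFinM !indicE -natrM mulnb E.
have H m k : steps m k (recf (k + m) s A) = recf k s A.
  elim: m k => [|m ih] k /=; first by rewrite addn0.
  by rewrite -addSnnS ih stepi_recf.
by rewrite -[X in recf X]add0n H.
Qed.

End product_measure.

Arguments cylinders {I d} T _.
Arguments prodM {I d} T.
Arguments rect {I d T} s A _.
Arguments prod_measure {R I d T} mu A.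

(** * Dynkin arguments for probability kernels *)

Lemma measure_bigcupT d (T : measurableType d) (R : realType)
    (mu : {measure set T -> \bar R}) (F : (set T)^nat) :
  (forall n, measurable (F n)) -> trivIset setT F ->
  mu (\bigcup_n F n) = (\sum_(n <oo) mu (F n))%E.
Proof.
move=> mF tF; rewrite measure_bigcup//; apply: eq_eseriesl => n.
by rewrite in_setT.
Qed.

Section pi_system.
Local Open Scope ereal_scope.
Context d (T : measurableType d) (R : realType).
Variable G : set (set T).
Hypothesis GE : @measurable _ T = <<s G >>.
Hypothesis GI : setI_closed G.

Lemma pi_system_eq (p q : probability T R) :
  (forall A, G A -> p A = q A) -> forall A, measurable A -> p A = q A.
Proof.
move=> pq A; rewrite GE; apply: (@dynkin_induction _ T G (fun A => p A = q A) GE GI) => //.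
- by rewrite !probability_setT.
- by move=> S mS pS; rewrite !probability_setC// pS.
- move=> F mF tF pF; rewrite !measure_bigcupT//.
  by apply: eq_eseriesr => n _; exact: pF.
Qed.

Lemma pi_system_measurable d' (Z : measurableType d') (k : Z -> probability T R) :
  (forall A, G A -> measurable_fun [set: Z] (fun z => k z A)) ->
  forall A, measurable A -> measurable_fun [set: Z] (fun z => k z A).
Proof.
move=> mk A; rewrite GE.
apply: (@dynkin_induction _ T G (fun A => measurable_fun [set: Z] (fun z => k z A)) GE GI) => //.
- rewrite (_ : (fun z => _) = cst 1); first exact: measurable_cst.
  by apply/funext => z; rewrite probability_setT.
- move=> S mS kS; rewrite (_ : (fun z => _) = (fun z => 1 - k z S)).
    by apply: emeasurable_funB => //; exact: measurable_cst.
  by apply/funext => z; rewrite probability_setC.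
- move=> F mF tF kF; rewrite (_ : (fun z => _) = (fun z => \sum_(n <oo) k z (F n))).
    by apply: ge0_emeasurable_sum => //.
  by apply/funext => z; rewrite measure_bigcupT.
Qed.

(** Both sides are finite measures in [A] with the same total mass [P D], so a conditional law needs
    to be checked on a generating pi-system only. *)
Lemma pi_system_integral d' (Om : measurableType d') (P : probability Om R)
    (k : Om -> probability T R) (Y : Om -> T) (D : set Om) :
  measurable_fun [set: Om] Y -> measurable D ->
  (forall A, measurable A -> measurable_fun [set: Om] (fun w => k w A)) ->
  (forall A, G A -> P (D `&` Y @^-1` A) = \int[P]_(w in D) k w A) ->
  forall A, measurable A -> P (D `&` Y @^-1` A) = \int[P]_(w in D) k w A.
Proof.
move=> mY mD mk PG A; rewrite GE.
have mYA S : measurable S -> measurable (Y @^-1` S).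
  by move=> mS; rewrite -[X in measurable X]setTI; exact: mY.
have PDT : P D = \int[P]_(w in D) k w setT.
  rewrite (eq_integral (cst 1)); last by move=> w _; rewrite probability_setT.
  by rewrite integral_cst// mul1e.
apply: (@dynkin_induction _ T G (fun A => P (D `&` Y @^-1` A) = \int[P]_(w in D) k w A) GE GI)
    => //.
- by rewrite preimage_setT setIT.
- move=> S mS PS; rewrite preimage_setC -setDE measureD//; last 2 first.
  + exact: mYA.
  + by rewrite -ge0_fin_numE// fin_num_measure.
  have -> : \int[P]_(w in D) k w (~` S) = \int[P]_(w in D) (k w setT - k w S).
    by apply: eq_integral => w _; rewrite probability_setC// probability_setT.
  have ik S' : measurable S' -> P.-integrable D (fun w => k w S').
    move=> mS'; apply: (@le_integrable _ _ _ P _ mD (fun w => k w S') (cst 1)).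
    + exact: measurable_funTS (mk _ mS').
    + by move=> w _; rewrite /= gee0_abs// normr1 probability_le1.
    + exact: finite_measure_integrable_cst.
  rewrite integralB//; [|exact: ik..].
  by rewrite -PDT -PS.
- move=> F mF tF PF; rewrite preimage_bigcup setI_bigcupr measure_bigcupT//; last 2 first.
  + by move=> n; apply: measurableI => //; exact: mYA.
  + move=> i j _ _ [x [[_ Fi] [_ Fj]]]; apply: tF => //; by exists (Y x).
  rewrite (eq_integral (fun w => \sum_(n <oo) k w (F n))); last first.
    by move=> w _; rewrite measure_bigcupT.
  rewrite integral_nneseries//; last first.
    by move=> n; exact: measurable_funTS (mk _ (mF n)).
  by apply: eq_eseriesr => n _; exact: PF.
Qed.

End pi_system.

(** * Borel sets of countable products *)

Section product_rectangles.
Local Open Scope ereal_scope.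
Context (I : countType) (d : I -> measure_display) (T : forall i, measurableType (d i)).

(** Asking for full sides off [s] lets rectangles with different index lists be intersected
    coordinate by coordinate. *)
Definition rects : set (set (forall i, T i)) :=
  [set B | exists s (A : forall i, set (T i)), [/\ uniq s, forall i, measurable (A i),
     forall i, i \notin s -> A i = setT & B = rect s A]].

Lemma rectT s (A : forall i, set (T i)) : (forall i, i \notin s -> A i = setT) ->
  rect s A = [set x | forall i, A i (x i)].
Proof.
move=> AT; apply/seteqP; split => x /= h i; last by move=> _; exact: h.
by have [/h//|/AT->] := boolP (i \in s).
Qed.

Lemma rects_setI : setI_closed rects.
Proof.
move=> _ _ [s [A [us mA AT ->]]] [t [B [ut mB BT ->]]].
exists (undup (s ++ t)), (fun i => A i `&` B i).
have ABT i : i \notin undup (s ++ t) -> A i `&` B i = setT.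
  by rewrite mem_undup mem_cat negb_or => /andP[/AT-> /BT->]; rewrite setIT.
split => //; [exact: undup_uniq|by move=> i; exact: measurableI|].
rewrite !rectT//; apply/seteqP; split => x /=.
  by move=> [h1 h2] i; split; [exact: h1|exact: h2].
by move=> h; split => i; have [] := h i.
Qed.

Lemma cylinders_rects : <<s cylinders T >> = <<s rects >>.
Proof.
apply/seteqP; split; apply: smallest_sub.
- exact: smallest_sigma_algebra.
- move=> _ [i [A [mA ->]]]; apply: sub_sigma_algebra.
  (* The factors have different types, so the side [A] at [i] is transported along the equality of
     indices. *)
  pose B j := if eqP is ReflectT e then ecast j (set (T j)) (e : i = j) A else setT : set (T j).
  have BE : B i = A.
    by rewrite /B; case: eqP => // e; rewrite (eq_irrelevance e (erefl _)).
  have BT j : i != j -> B j = setT by rewrite /B; case: eqP.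
  exists [:: i], B; split => //.
  + by move=> j; rewrite /B; case: eqP => // e; case: j / e.
  + by move=> j; rewrite inE eq_sym => /BT.
  apply/seteqP; split => x /=.
    by move=> Ax j; rewrite inE => /eqP ->; rewrite BE.
  by move=> /(_ i); rewrite mem_head BE; apply.
- exact: smallest_sigma_algebra.
- by move=> _ [s [A [us mA AT ->]]]; exact: measurable_rect.
Qed.

End product_rectangles.
Arguments rects {I d} T _.

Section countable_base.

Definition countable_basis (T : topologicalType) (U : nat -> set T) :=
  (forall n, open (U n)) /\
  forall O x, open O -> O x -> exists n, U n x /\ U n `<=` O.

(** Finite lists of basic constraints through [x] generate a filter. The product topology is a
    supremum of initial topologies, so convergence of this filter to [x] is tested on one coordinate
    at a time, and then it contains every neighbourhood of [x]. *)
Lemma countable_basis_prod (I : countType) (T : I -> topologicalType) (U : forall i, nat -> set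
    (T i)) :
  (forall i, countable_basis (U i)) -> forall (O : set (prod_topology T)) x, open O -> O x ->
  exists s : seq (I * nat), (forall p, p \in s -> U p.1 p.2 (x p.1)) /\
     (forall y : prod_topology T, (forall p, p \in s -> U p.1 p.2 (y p.1)) -> O y).
Proof.
move=> bU O x oO Ox.
pose F : set_system (prod_topology T) := [set A | exists s : seq (I * nat),
  (forall p, p \in s -> U p.1 p.2 (x p.1)) /\
  (forall y : prod_topology T, (forall p, p \in s -> U p.1 p.2 (y p.1)) -> A y)].
have FF : Filter F.
  split.
  - by exists [::].
  - move=> A B [s [s1 s2]] [t [t1 t2]]; exists (s ++ t); split.
      by move=> p; rewrite mem_cat => /orP[/s1|/t1].
    move=> y h; split; [apply: s2|apply: t2] => p ps; apply: h; by rewrite mem_cat ps ?orbT.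
  - by move=> A B AB [s [s1 s2]]; exists s; split => // y /s2/AB.
have : F --> x.
  apply/cvg_sup => i A [V] [[W] oW <-] Wx WA.
  have [n [Unx UnW]] := (bU i).2 _ _ oW Wx.
  exists [:: (i, n)]; split => [p|y]; first by rewrite inE => /eqP->.
  by move=> /(_ (i, n)); rewrite mem_head => /(_ isT) /UnW; exact: WA.
by apply; apply: open_nbhs_nbhs; split.
Qed.

Lemma open_borel (T : ptopologicalType) (O : set T) : open O -> measurable (O : set (borel T)).
Proof. by move=> oO; exact: sub_sigma_algebra. Qed.

Lemma measurable_fun_borel d (Z : measurableType d) (T : ptopologicalType) (f : Z -> T) :
  (forall O, open O -> measurable (f @^-1` O)) -> measurable_fun [set: Z] (f : Z -> borel T).
Proof. by move=> fO; apply: measurable_fun_gen. Qed.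

Lemma continuous_borel (T T' : ptopologicalType) (f : T -> T') : continuous f ->
  measurable_fun [set: borel T] (f : borel T -> borel T').
Proof.
move=> cf; apply: measurable_fun_borel => O oO; apply: open_borel.
by apply: open_comp => // x _; exact: cf.
Qed.

Lemma measurable_proj (I : eqType) (T : I -> ptopologicalType) i :
  measurable_fun [set: borel (prod_topology T)]
    ((fun x => x i) : borel (prod_topology T) -> borel (T i)).
Proof. by apply: (@continuous_borel (prod_topology T) (T i)); exact: proj_continuous. Qed.

(** An open set is the union of the finite basic boxes that it contains. Boxes are indexed by lists
    of pairs, a countable type, so the union is countable; codes of no use contribute [set0]. *)
Lemma borel_prod (I : countType) (T : I -> ptopologicalType) (U : forall i, nat -> set (T i)) :
  (forall i, countable_basis (U i)) ->
  @measurable _ (borel (prod_topology T)) = <<s cylinders (fun i => borel (T i)) >>.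
Proof.
move=> bU; apply/seteqP; split; apply: smallest_sub.
- exact: smallest_sigma_algebra.
- move=> O oO.
  pose B (s : seq (I * nat)) : set (prod_topology T) :=
    [set y | forall p, p \in s -> U p.1 p.2 (y p.1)].
  have mB s : <<s cylinders (fun i => borel (T i)) >> (B s).
    elim: s => [|p s ih].
      by rewrite (_ : B _ = setT); [exact: (@measurableT _ (prodM _))|exact/seteqP].
    rewrite (_ : B _ = [set y : prod_topology T | U p.1 p.2 (y p.1)] `&` B s).
      apply: (@measurableI _ (prodM (fun i => borel (T i)))) => //.
      apply: sub_sigma_algebra; exists p.1, (U p.1 p.2); split => //.
      by apply: open_borel; exact: (bU _).1.
    apply/seteqP; split => y /=.
      move=> h; split; first by apply: h; rewrite mem_head.
      by move=> q qs; apply: h; rewrite inE qs orbT.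
    by move=> [h1 h2] q; rewrite inE => /orP[/eqP->|/h2].
  pose F n := if @unpickle (seq (I * nat)) n is Some s then
    (if `[< B s `<=` O >] then B s else set0) else set0.
  rewrite (_ : O = \bigcup_n F n).
    apply: (@bigcupT_measurable _ (prodM (fun i => borel (T i)))) => n.
    rewrite /F; case: unpickle => [s|]; last exact: (@measurable0 _ (prodM _)).
    by case: asboolP => _; [exact: mB|exact: (@measurable0 _ (prodM _))].
  apply/seteqP; split => x.
    move=> Ox; have [s [s1 s2]] := countable_basis_prod bU oO Ox.
    exists (pickle s) => //; rewrite /F pickleK; case: asboolP => // -[] y /s2//.
  move=> [n _]; rewrite /F; case: unpickle => [s|//]; case: asboolP => // h; exact: h.
- exact: smallest_sigma_algebra.
- move=> _ [i [A [mA ->]]].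
  have := @measurable_proj I T i measurableT A mA.
  by rewrite setTI.
Qed.

Lemma borel_prod_rects (I : countType) (T : I -> ptopologicalType) (U : forall i, nat -> set (T
    i)) :
  (forall i, countable_basis (U i)) ->
  @measurable _ (borel (prod_topology T)) = <<s rects (fun i => borel (T i)) >>.
Proof. by move=> bU; rewrite (borel_prod bU) cylinders_rects. Qed.

Lemma measurable_fun_prod d (Z : measurableType d) (I : countType) (T : I -> ptopologicalType)
    (U : forall i, nat -> set (T i)) (f : Z -> prod_topology T) :
  (forall i, countable_basis (U i)) ->
  (forall i, measurable_fun [set: Z] ((fun z => f z i) : Z -> borel (T i))) ->
  measurable_fun [set: Z] (f : Z -> borel (prod_topology T)).
Proof.
move=> bU mf.
have h : measurable_fun [set: Z] (f : Z -> prodM (fun i => borel (T i))).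
  apply: measurable_fun_gen => _ [i [A [mA ->]]].
  by have := mf i measurableT A mA; rewrite setTI.
move=> _ A; rewrite (borel_prod bU) => mA; exact: h.
Qed.

Lemma countable_basis_prod_ex (I : countType) (T : I -> topologicalType) (U : forall i, nat ->
    set (T i)) :
  (forall i, countable_basis (U i)) -> exists V : nat -> set (prod_topology T), countable_basis V.
Proof.
move=> bU.
pose B (s : seq (I * nat)) : set (prod_topology T) :=
  [set y | forall p, p \in s -> U p.1 p.2 (y p.1)].
have oB s : open (B s).
  elim: s => [|p s ih]; first by rewrite (_ : B _ = setT); [exact: openT|exact/seteqP].
  rewrite (_ : B _ = (fun y : prod_topology T => y p.1) @^-1` (U p.1 p.2) `&` B s).
    apply: openI => //; apply: open_comp; last exact: (bU _).1.
    by move=> x _; exact: proj_continuous.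
  apply/seteqP; split => y /=.
    move=> h; split; first by apply: h; rewrite mem_head.
    by move=> q qs; apply: h; rewrite inE qs orbT.
  by move=> [h1 h2] q; rewrite inE => /orP[/eqP->|/h2].
exists (fun n => if @unpickle (seq (I * nat)) n is Some s then B s else set0); split.
  by move=> n; case: unpickle => [s|]; [exact: oB|exact: open0].
move=> O x oO Ox; have [s [s1 s2]] := countable_basis_prod bU oO Ox.
by exists (pickle s); rewrite pickleK.
Qed.

Lemma polish_countable_basis (R : realType) (T : completePseudoMetricType R) : polish T ->
  exists U : nat -> set T, countable_basis U.
Proof.
move=> [_ [D [/countable_injP[f finj] dD]]].
pose U (p : nat * nat) : set T :=
  \bigcup_(a in [set x | D x /\ f x = p.1]) (ball a (p.2.+1%:R^-1 : R))^°.
have oU p : open (U p) by apply: bigcup_open => a _; exact: open_interior.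
exists (fun n => if @unpickle (nat * nat)%type n is Some p then U p else set0); split.
  by move=> n; case: unpickle => [p|]; [exact: oU|exact: open0].
move=> O x oO Ox.
have /nbhs_ballP[e /= e0 eO] : nbhs x O by apply: open_nbhs_nbhs; split.
(* With [r] half the radius [k.+1%:R^-1], the centre is taken within [r] of [x] and its ball of
   radius [2 * r] stays within [3 * r] of [x]; the choice of [k] gives [4 * r < e]. *)
have [k ke] : exists k : nat, (2 * k.+1%:R^-1 : R) < e.
  have e2 : 0 < e / 2 by rewrite divr_gt0.
  near \oo => k; exists k; rewrite mulrC -ltr_pdivlMr//.
  near: k; exact: near_infty_natSinv_lt (PosNum e2).
pose r : R := k.+1%:R^-1 / 2.
have r0 : 0 < r by rewrite divr_gt0// invr_gt0 ltr0n.
have rr : k.+1%:R^-1 = r + r by rewrite /r -splitr.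
have : (ball x r)^° !=set0.
  by exists x; exact: nbhsx_ballx.
move=> /dD/(_ (@open_interior _ _))[a [/interior_subset xa Da]].
exists (pickle (f a, k)); rewrite pickleK; split.
  exists a => //=; rewrite rr; apply: (@filterS _ _ _ (ball x r)); last exact: nbhsx_ballx.
  by move=> y; apply: ball_triangle; exact: ball_sym.
move=> y [b /= [Db fba]]; have -> : b = a by apply: finj; rewrite ?inE.
move=> /interior_subset; rewrite rr => ay; apply: eO.
apply: (@le_ball _ _ _ (r + (r + r))); last exact: ball_triangle xa ay.
by move: ke; rewrite rr; lra.
Unshelve. all: by end_near. Qed.

End countable_base.

(** * The weak Borel sigma-algebra *)

Lemma continuous_measurable (R : realType) (T : ptopologicalType) (f : T -> R) :
  continuous f -> measurable_fun [set: borel T] (f : borel T -> R).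
Proof.
move=> cf; apply: (@measurability _ _ (borel T) R setT f _ (RGenOpens.measurableE R)).
move=> _ [_ [a [b ->]] <-]; rewrite setTI; apply: open_borel.
apply: open_comp; last exact: interval_open.
by move=> x _; exact: cf.
Qed.

Section bounded_integral.
Context d (T : measurableType d) (R : realType) (mu : probability T R).

Lemma bounded_integrable (D : set T) (f : T -> R) (M : R) : measurable D -> measurable_fun D f ->
  (forall x, D x -> `|f x| <= M) -> mu.-integrable D (EFin \o f).
Proof.
move=> mD mf fM.
apply: (@le_integrable _ _ _ mu _ mD _ (cst M%:E)).
- exact/measurable_EFinP.
- by move=> x Dx; rewrite /= lee_fin; apply: le_trans (fM _ Dx) (ler_norm _).
- exact: finite_measure_integrable_cst.
Qed.

Lemma bounded_cvg_integral (D : set T) (fn : nat -> T -> R) (f : T -> R) (M : R) : measurable D ->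
  (forall n, measurable_fun D (fn n)) -> measurable_fun D f ->
  (forall n x, D x -> `|fn n x| <= M) ->
  {ae mu, forall x, D x -> fn n x @[n --> \oo] --> f x} ->
  (\int[mu]_(x in D) (fn n x)%:E @[n --> \oo] --> \int[mu]_(x in D) (f x)%:E)%E.
Proof.
move=> mD mfn mf fnM cvf.
have [] // := @dominated_convergence _ _ _ mu _ mD (fun n x => (fn n x)%:E)
  (fun x => (f x)%:E) (cst M%:E).
- by move=> n; exact/measurable_EFinP.
- exact/measurable_EFinP.
- apply: filterS cvf => x h Dx; apply: cvg_EFin; first exact: nearW.
  exact: h.
- exact: finite_measure_integrable_cst.
- by apply: aeW => x n Dx; rewrite /= lee_fin fnM.
Qed.

End bounded_integral.

Section weak.
Context (R : realType) (T : ptopologicalType).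

Lemma bcont_integrable (mu : Prob T R) (f : T -> R) : bcont f ->
  mu.-integrable setT (EFin \o (f : borel T -> R)).
Proof.
move=> [cf [M fM]]; apply: (@bounded_integrable _ _ _ mu _ _ M) => //.
exact: continuous_measurable.
Qed.

Lemma integE (mu : Prob T R) (f : T -> R) : bcont f ->
  (integ mu f)%:E = (\int[mu]_(x in setT) (f x)%:E)%E.
Proof.
move=> bf; rewrite /integ /Rintegral fineK//.
exact: integrable_fin_num (bcont_integrable mu bf).
Qed.

Definition probW : measurableType (sigma_display (weak_open T R)) :=
  g_sigma_algebraType (weak_open T R).

Variable U : nat -> set T.
Hypothesis bU : countable_basis U.

Let V (s : seq nat) : set T := \big[setU/set0]_(i <- s) U i.
Let oV s : open (V s).
Proof. by rewrite /V; elim/big_ind: _ => //; [exact: open0|exact: openU|move=> i _; exact: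
    bU.1]. Qed.

(** Finite unions of basic open sets and rational thresholds leave countably many such sets. Lower
    bounds on masses of open sets suffice: every weakly open set is a union of sets of this form, by
    [bnbhs_weak_open]. *)
Let basic (s : seq (seq nat * rat)) : set (Prob T R) :=
  [set nu | forall p, p \in s -> (((ratr p.2 : R)%:E) < nu (V p.1))%E].

Let bnbhs (mu : Prob T R) (A : set (Prob T R)) := exists s, basic s mu /\ basic s `<=` A.

Let bnbhsI mu A B : bnbhs mu A -> bnbhs mu B -> bnbhs mu (A `&` B).
Proof.
move=> [s [s1 s2]] [t [t1 t2]]; exists (s ++ t); split.
  by move=> p; rewrite mem_cat => /orP[/s1|/t1].
by move=> nu h; split; [apply: s2|apply: t2] => p ps; apply: h; rewrite mem_cat ps ?orbT.
Qed.

Let bnbhsS mu A B : A `<=` B -> bnbhs mu A -> bnbhs mu B.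
Proof. by move=> AB [s [s1 s2]]; exists s; split => // nu /s2/AB. Qed.

Let bnbhs_forall (I : eqType) (s : seq I) mu (A : I -> set (Prob T R)) :
  (forall i, i \in s -> bnbhs mu (A i)) -> bnbhs mu [set nu | forall i, i \in s -> A i nu].
Proof.
elim: s => [_|i s ih h].
  by exists [::]; split => // nu _ i.
have ihs : bnbhs mu [set nu | forall i, i \in s -> A i nu].
  by apply: ih => j js; apply: h; rewrite inE js orbT.
apply: bnbhsS (bnbhsI (h i (mem_head _ _)) ihs) => nu [h1 h2] j.
by rewrite inE => /orP[/eqP->|/h2].
Qed.

(** [A] is the increasing union of the finite unions [F n] of basic sets inside it; continuity from
    below gives one of mass above [r], with room for a rational threshold. *)
Let bnbhs_open (mu : Prob T R) (A : set T) (r : R) : open A -> (r%:E < mu (A : set (borel T)))%E ->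
  bnbhs mu [set nu | (r%:E < nu A)%E].
Proof.
move=> oA rA.
pose G i : set T := if `[< U i `<=` A >] then U i else set0.
have oG i : open (G i) by rewrite /G; case: asboolP => // _; [exact: bU.1|exact: open0].
have GA i : G i `<=` A by rewrite /G; case: asboolP => // _ x [].
pose F n : set (borel T) := \big[setU/set0]_(i < n) G i.
have FP n x : F n x <-> exists2 i, (i < n)%N & G i x by rewrite /F -bigcup_mkord.
have AF : A = \bigcup_n F n.
  apply/seteqP; split => x.
    move=> Ax; have [n [Unx UnA]] := bU.2 _ _ oA Ax.
    exists n.+1 => //; apply/FP; exists n => //=; rewrite /G.
    by case: asboolP.
  by move=> [n _] /FP[i _]; exact: GA.
have mF n : measurable (F n).
  by apply: bigsetU_measurable => i _; exact: open_borel.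
have : mu (F n) @[n --> \oo] --> mu A.
  rewrite AF; apply: nondecreasing_cvg_mu => //; first exact: bigcupT_measurable.
  move=> n m nm; apply/subsetPset => x /FP[i ii h]; apply/FP; exists i => //.
  exact: leq_trans nm.
move=> cvF; have [n rF] : exists n, (r%:E < mu (F n))%E.
  apply: contrapT => /forallNP nF; move: rA; rewrite ltNge => /negP; apply.
  rewrite -(cvg_lim _ cvF)//; apply: lime_le; first by apply/cvg_ex; exists (mu A).
  by apply: nearW => n; rewrite leNgt; apply/negP; exact: nF.
have fF : mu (F n) \is a fin_num by exact: fin_num_measure.
have [q /andP[rq qF]] : exists q : rat, r < ratr q < fine (mu (F n)).
  have := @rat_in_itvoo R r (fine (mu (F n))).
  rewrite -lte_fin fineK// => /(_ rF) [q]; rewrite in_itv /= => h.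
  by exists q.
exists [:: ([seq i <- iota 0 n | `[< U i `<=` A >]], q)].
have VF : V [seq i <- iota 0 n | `[< U i `<=` A >]] = F n.
  rewrite /V /F big_filter big_mkcond /= -(big_mkord xpredT G).
  by rewrite /index_iota subn0.
split => [p|nu].
  by rewrite inE => /eqP -> /=; rewrite VF -(fineK fF) lte_fin.
move=> /(_ _ (mem_head _ _)) /=; rewrite VF => qn.
apply: lt_le_trans (_ : nu (F n) <= _)%E; last first.
  apply: le_measure; rewrite ?inE//; first exact: open_borel.
  by rewrite AF; exact: bigcup_sup.
by apply: lt_trans qn; rewrite lte_fin.
Qed.

(* Layer cake: [S m] is the sum of the [h * \1_(A l)] with [A l] the open set where
   [l.+1 * h < f], and [f - h <= S m <= f]. *)
Let bnbhs_lsc_ge0 (mu : Prob T R) (f : T -> R) (e : R) : bcont f -> (forall x, 0 <= f x) -> 0 < e ->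
  bnbhs mu [set nu | integ mu f - e < integ nu f].
Proof.
move=> bf f0 e0; have [cf [M fM]] := bf.
pose h := e / 3.
have h0 : 0 < h by rewrite divr_gt0.
have [m Mm] : exists m : nat, M <= m%:R * h.
  exists (Num.trunc (`|M| / h)).+1; rewrite -ler_pdivrMr//.
  apply: le_trans (ltW (truncnS_gt _)).
  by rewrite ler_pM2r ?invr_gt0// ler_norm.
pose A (l : nat) : set (borel T) := [set x | l.+1%:R * h < f x].
have oA l : open (A l : set T).
  rewrite (_ : A l = f @^-1` [set y | l.+1%:R * h < y])//.
  by apply: open_comp; [move=> x _; exact: cf|exact: open_gt].
have mA l : measurable (A l) by exact: open_borel.
pose S (k : nat) (x : T) : R := \sum_(l < k) h * \1_(A l) x.
have Sle k x : S k x <= f x /\ S k x <= k%:R * h.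
  elim: k => [|k [ih1 ih2]]; first by rewrite /S big_ord0 mul0r f0.
  rewrite /S big_ord_recr /= -/(S k x) indicE.
  have [/set_mem Ax|nAx] := boolP (x \in A k).
    rewrite mulr1.
    have Ax' : k.+1%:R * h < f x by exact: Ax.
    have E : k.+1%:R * h = k%:R * h + h by rewrite -natr1 mulrDl mul1r.
    by rewrite E in Ax' *; split; [apply: ltW; apply: le_lt_trans Ax'|]; rewrite lerD2r.
  rewrite mulr0 addr0; split => //; apply: le_trans ih2 _.
  by apply: ler_wpM2r; [exact: ltW|rewrite ler_nat].
have Sge k x : f x <= k%:R * h + h -> f x - h <= S k x.
  elim: k => [|k ih fx]; first by rewrite /S big_ord0 mul0r add0r subr_le0.
  rewrite /S big_ord_recr /= -/(S k x) indicE.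
  have E : k.+1%:R * h = k%:R * h + h by rewrite -natr1 mulrDl mul1r.
  have [/set_mem Ax|nAx] := boolP (x \in A k).
    have Ax' : k.+1%:R * h < f x by exact: Ax.
    have : k%:R * h <= S k x.
      have HH j : (j <= k)%N -> S j x = j%:R * h.
        elim: j => [|j ihj jk]; first by rewrite /S big_ord0 mul0r.
        rewrite /S big_ord_recr /= -/(S j x) ihj 1?ltnW// indicE mem_set ?mulr1.
          by rewrite -natr1 mulrDl mul1r.
        apply: le_lt_trans Ax'; rewrite ler_pM2r// ler_nat.
        exact: leqW.
      by rewrite HH.
    by move: fx; rewrite mulr1 E; lra.
  rewrite mulr0 addr0; apply: ih; rewrite -E leNgt; apply/negP => h'.
  by move/negP: nAx; apply; apply/mem_set.
have SE (nu : Prob T R) : (\int[nu]_x (S m x)%:E = \sum_(l < m) h%:E * nu (A l))%E.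
  under eq_integral do rewrite /S -sumEFin.
  rewrite ge0_integral_sum//; last 2 first.
  - by move=> l; apply/measurable_EFinP; apply: measurable_funM.
  - by move=> l x _; rewrite lee_fin mulr_ge0// ltW.
  apply: eq_bigr => l _; under eq_integral do rewrite EFinM.
  rewrite ge0_integralZl_EFin//; [|by apply/measurable_EFinP; exact: measurable_indic|exact: ltW].
  by rewrite integral_indic// setIT.
have mS : measurable_fun [set: borel T] (S m).
  apply: measurable_sum => l; apply: measurable_funM => //; exact: measurable_indic.
have mf : measurable_fun [set: borel T] (f : borel T -> R) by exact: continuous_measurable.
have low (nu : Prob T R) : \sum_(l < m) h * fine (nu (A l)) <= integ nu f.
  rewrite -lee_fin integE// -sumEFin.
  rewrite (eq_bigr (fun l : 'I_m => h%:E * nu (A l))%E); last first.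
    by move=> l _; rewrite EFinM fineK// fin_num_measure.
  rewrite -SE; apply: ge0_le_integral => //.
  - by move=> x _; rewrite lee_fin /S sumr_ge0// => l _; rewrite mulr_ge0// ltW.
  - exact/measurable_EFinP.
  - by apply/measurable_EFinP.
  - by move=> x _; rewrite lee_fin; exact: (Sle m x).1.
have upp : integ mu f <= h + \sum_(l < m) h * fine (mu (A l)).
  rewrite -lee_fin integE// EFinD -sumEFin.
  rewrite (eq_bigr (fun l : 'I_m => h%:E * mu (A l))%E); last first.
    by move=> l _; rewrite EFinM fineK// fin_num_measure.
  rewrite -SE -[X in (X + _)%E](_ : (\int[mu]_(x in setT) h%:E = _)%E); last first.
    by rewrite integral_cst// [X in (_ * X)%E]probability_setT mule1.
  rewrite -ge0_integralD//; last 3 first.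
  - by move=> x _; rewrite lee_fin ltW.
  - by move=> x _; rewrite lee_fin /S sumr_ge0// => l _; rewrite mulr_ge0// ltW.
  - exact/measurable_EFinP.
  apply: ge0_le_integral => //.
  - by move=> x _; rewrite lee_fin.
  - by apply/measurable_EFinP.
  - apply: emeasurable_funD => //; exact/measurable_EFinP.
  - move=> x _; rewrite -EFinD lee_fin -lerBlDl; apply: Sge.
    apply: le_trans (ler_norm _) _; apply: le_trans (fM x) _.
    by apply: le_trans Mm _; rewrite lerDl ltW.
(* The [m] layers lose at most [h * m * dl <= h] in total and the discretisation loses [h]; as
   [e = 3 * h], the inequality stays strict. *)
pose dl : R := (m.+1)%:R^-1.
have dl0 : 0 < dl by rewrite invr_gt0.
have H : bnbhs mu [set nu : Prob T R | forall l, l \in iota 0 m -> ((fine (mu (A l)) - dl)%:E <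
    nu (A l))%E].
  apply: bnbhs_forall => l _; apply: bnbhs_open => //.
  rewrite -[X in (_ < X)%E]fineK ?fin_num_measure// lte_fin.
  by rewrite ltrBlDr ltrDl.
apply: bnbhsS H => nu hnu /=.
apply: lt_le_trans (low nu).
have : \sum_(l < m) h * fine (mu (A l)) - h <= \sum_(l < m) h * fine (nu (A l)).
  rewrite lerBlDr.
  apply: (@le_trans _ _ (\sum_(l < m) (h * fine (nu (A l)) + h * dl))).
    apply: ler_sum => l _; rewrite -mulrDr ler_pM2l//.
    have /hnu : (l : nat) \in iota 0 m by rewrite mem_iota /=.
    rewrite -[X in (_ < X)%E]fineK ?fin_num_measure// lte_fin => /ltW.
    by rewrite lerBlDr.
  rewrite big_split /= lerD2l sumr_const card_ord -mulr_natr -mulrA ler_piMr// ?ltW//.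
  by rewrite mulrC /dl ltr_pdivrMr// mul1r ltr_nat.
have : 3 * h = e by rewrite /h mulrC divfK.
move: upp; lra.
Qed.

(** Adding the constant [|M|] makes [f] nonnegative and shifts its integral by the same amount under
    every probability. *)
Let bnbhs_lsc (mu : Prob T R) (f : T -> R) (e : R) : bcont f -> 0 < e ->
  bnbhs mu [set nu | integ mu f - e < integ nu f].
Proof.
move=> bf e0; have [cf [M fM]] := bf.
pose g x := f x + `|M|.
have bg : bcont g.
  split; first by move=> x; apply: cvgD; [exact: cf|exact: cvg_cst].
  exists (M + `|M|) => x; apply: le_trans (ler_normD _ _) _.
  by rewrite normr_id lerD2r.
have g0 x : 0 <= g x.
  rewrite /g -lerBlDr sub0r lerNl; apply: le_trans (ler_norm _) _.
  by rewrite normrN; apply: le_trans (fM x) (ler_norm _).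
have E nu : integ nu g = integ nu f + `|M|.
  apply: EFin_inj; rewrite EFinD !integE//.
  under eq_integral do rewrite EFinD.
  rewrite integralD//=; last 2 first.
  - exact: bcont_integrable.
  - exact: finite_measure_integrable_cst.
  by rewrite integral_cst// [X in (_ * X)%E]probability_setT mule1.
apply: bnbhsS (bnbhs_lsc_ge0 mu bg g0 e0) => nu /=.
rewrite !E; lra.
Qed.

(** A two-sided bound on [integ nu (fs j)] is a pair of lower bounds, one for [fs j] and one for its
    opposite. *)
Let bnbhs_weak_open (B : set (Prob T R)) mu : weak_open T R B -> B mu -> bnbhs mu B.
Proof.
move=> oB Bmu; have [k [fs [e [e0 bfs sub]]]] := oB mu Bmu.
apply: bnbhsS sub _.
have H : bnbhs mu [set nu : Prob T R | forall j, j \in enum 'I_k ->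
    ([set nu | integ mu (fs j) - e < integ nu (fs j)] `&`
     [set nu | integ mu (fun x => - fs j x) - e < integ nu (fun x => - fs j x)]) nu].
  apply: bnbhs_forall => j _; apply: bnbhsI; first exact: bnbhs_lsc.
  apply: bnbhs_lsc => //; have [cf [M fM]] := bfs j; split.
    by move=> x; apply: cvgN; exact: cf.
  by exists M => x; rewrite normrN.
apply: bnbhsS H => nu h j /=.
have [/= h1 h2] := h j (mem_enum _ _).
have N (nu' : Prob T R) : integ nu' (fun x => - fs j x) = - integ nu' (fs j).
  rewrite (_ : (fun x => - fs j x) = (fun x => -1 * fs j x)); last first.
    by apply/funext => x; rewrite mulN1r.
  by rewrite /integ RintegralZl ?mulN1r//; exact: (bcont_integrable nu' (bfs j)).
rewrite !N in h2; rewrite ltr_norml; apply/andP; split; lra.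
Qed.

(** A weakly open set is the union of the countably many sets [basic s] that it contains, and the
    preimage of [basic s] is a finite intersection of conditions on masses of open sets. *)
Lemma measurable_fun_probW d (Z : measurableType d) (k : Z -> Prob T R) :
  (forall W, open W -> measurable_fun [set: Z] (fun z => k z W)) ->
  forall B, weak_borel T R B -> measurable (k @^-1` B).
Proof.
move=> mk.
suff H : measurable_fun [set: Z] (k : Z -> probW).
  by move=> B wB; have := H measurableT B wB; rewrite setTI.
apply: measurable_fun_gen => B oB.
pose F n : set (Prob T R) := if @unpickle (seq (seq nat * rat)) n is Some s then
    (if `[< basic s `<=` B >] then basic s else set0) else set0.
have -> : B = \bigcup_n F n.
  apply/seteqP; split => x.
    move=> Bx; have [s [s1 s2]] := bnbhs_weak_open oB Bx.
    by exists (pickle s) => //; rewrite /F pickleK; case: asboolP.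
  by move=> [n _]; rewrite /F; case: unpickle => [s|//]; case: asboolP => // h; exact: h.
rewrite preimage_bigcup; apply: bigcupT_measurable => n; rewrite /F.
case: unpickle => [s|]; last by rewrite preimage_set0.
case: asboolP => _; last by rewrite preimage_set0.
elim: s => [|p s ih].
  rewrite (_ : _ @^-1` _ = setT)//; exact/seteqP.
rewrite (_ : _ @^-1` _ = [set z | ((ratr p.2 : R)%:E < k z (V p.1))%E] `&` k @^-1` (basic s)).
  apply: measurableI => //; rewrite -[X in measurable X]setTI.
  apply: emeasurable_fun_o_infty => //; exact: mk.
apply/seteqP; split => y /=.
  move=> h; split; first by apply: h; rewrite mem_head.
  by move=> q qs; apply: h; rewrite inE qs orbT.
by move=> [h1 h2] q; rewrite inE => /orP[/eqP->|/h2].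
Qed.

End weak.
Arguments probW R T : clear implicits.

(** * Approximation of open sets by continuous functions *)

Section weak_metric.
Context (R : realType) (T : completePseudoMetricType R).

(** Urysohn functions that vanish off [O] and equal [1] at the points whose ball of radius
    [n.+1%:R^-1] lies in [O]; every point of [O] is eventually of this kind. *)
Lemma open_approx (O : set T) : open O -> exists f : nat -> T -> R,
  [/\ forall n, continuous (f n), forall n x, 0 <= f n x <= 1 &
      forall x, f n x @[n --> \oo] --> (\1_O x : R)].
Proof.
move=> oO.
pose Cl n : set T := [set x | ball x (n.+1%:R^-1 : R) `<=` O].
have sep n : uniform_separator (~` O) (Cl n).
  apply: uniform_separatorW; exists [set xy : T * T | ball xy.1 (n.+1%:R^-1 : R) xy.2].
    by apply: entourage_ball (PosNum _); rewrite invr_gt0 ltr0n.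
  apply/seteqP; split => // -[x y] [] /= [nOx Cy] xy; apply: nOx; apply: Cy.
  exact: ball_sym.
exists (fun n => Urysohn (~` O) (Cl n)); split.
- by move=> n; exact: Urysohn_continuous.
- move=> n x; have := @Urysohn_range T R (~` O) (Cl n) (Urysohn (~` O) (Cl n) x).
  by move=> /(_ (ex_intro2 _ _ x Logic.I erefl)) /=; rewrite in_itv.
- move=> x; rewrite indicE; have [/set_mem Ox|nOx] := boolP (x \in O).
    have /nbhs_ballP[e /= e0 eO] : nbhs x O by apply: open_nbhs_nbhs; split.
    apply: cvg_near_cst; near=> n.
    apply/eqP; rewrite eq_sym; apply/eqP; apply/esym.
    apply: (@Urysohn_sub1 T R _ _ (sep n)); exists x => //.
    apply: subset_trans eO; apply: le_ball; apply: ltW; near: n.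
    exact: near_infty_natSinv_lt (PosNum e0).
  rewrite (_ : (fun n => _) = fun=> 0); first exact: cvg_cst.
  apply/funext => n; apply: (@Urysohn_sub0 T R _ _ (sep n)); exists x => //.
  by move=> Ox; move/negP: nOx; apply; exact/mem_set.
Unshelve. all: by end_near. Qed.

Lemma measurable_integ (f : T -> R) : bcont f ->
  measurable_fun [set: probW R T] (fun nu : probW R T => integ nu f).
Proof.
move=> bf; apply: (measurability _ (RGenOInfty.measurableE R)) => //.
move=> _ [_ [r ->] <-]; rewrite setTI; apply: sub_sigma_algebra => mu /=.
rewrite in_itv /= andbT => rmu.
exists 1%N, (fun=> f), (integ mu f - r); split => //; first by rewrite subr_gt0.
move=> nu /(_ ord0) /=; rewrite in_itv /= andbT ltr_norml => /andP[+ _].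
by lra.
Qed.

Lemma integ01 (nu : Prob T R) (f : T -> R) : bcont f -> (forall x, 0 <= f x <= 1) ->
  0 <= integ nu f <= 1.
Proof.
move=> bf f01; rewrite -!lee_fin integE//; apply/andP; split.
  by apply: integral_ge0 => x _; rewrite lee_fin; have /andP[] := f01 x.
rewrite -[X in (_ <= X)%E](_ : (\int[nu]_(x in setT) 1%:E = _)%E); last first.
  by rewrite integral_cst// [X in (_ * X)%E]probability_setT mule1.
have [cf _] := bf; apply: ge0_le_integral => //.
- by move=> x _; rewrite lee_fin; have /andP[] := f01 x.
- by apply/measurable_EFinP; exact: continuous_measurable.
- by move=> x _; rewrite lee_fin; have /andP[] := f01 x.
Qed.

Lemma approx_integ (nu : Prob T R) (O : set T) (f : nat -> T -> R) : open O ->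
  (forall n, continuous (f n)) -> (forall n x, 0 <= f n x <= 1) ->
  (forall x, f n x @[n --> \oo] --> (\1_O x : R)) ->
  (integ nu (f n))%:E @[n --> \oo] --> nu (O : set (borel T)).
Proof.
move=> oO cf f01 fO.
have bf n : bcont (f n).
  split; first exact: cf.
  by exists 1 => x; have /andP[f0 f1] := f01 n x; rewrite ger0_norm.
under eq_fun do rewrite integE//.
have -> : nu (O : set (borel T)) = (\int[nu]_(x in setT) (\1_O x : R)%:E)%E.
  by rewrite integral_indic ?setIT//; exact: open_borel.
apply: (@bounded_cvg_integral _ _ _ _ _ _ _ 1) => //.
- by move=> n; exact: continuous_measurable.
- by apply: measurable_indic; exact: open_borel.
- by move=> n x _; have /andP[f0 f1] := f01 n x; rewrite ger0_norm.
- by apply: aeW => x _; exact: fO.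
Qed.

(** The counterpart of [measurable_fun_probW]: on an open set the mass is a limit of integrals of
    bounded continuous functions, and open sets form a pi-system. *)
Lemma measurable_ev (A : set (borel T)) : measurable A ->
  measurable_fun [set: probW R T] (fun nu : probW R T => (nu : Prob T R) A).
Proof.
apply: (@pi_system_measurable _ (borel T) R (@open T) _ _ _ (probW R T) (fun nu : probW R T =>
    nu : Prob T R)) => //.
  exact: openI.
move=> O oO; have [f [cf f01 fO]] := open_approx oO.
have bf n : bcont (f n).
  split; first exact: cf.
  by exists 1 => x; have /andP[f0 f1] := f01 n x; rewrite ger0_norm.
apply: (emeasurable_fun_cvg (fun n (nu : probW R T) => (integ nu (f n))%:E)).
  by move=> n; apply/measurable_EFinP; exact: measurable_integ.
by move=> nu _; exact: approx_integ.
Qed.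

End weak_metric.

(** * Sampling without replacement *)

Section dirac_mean.
Local Open Scope ereal_scope.
Context d (T : measurableType d) (R : realType) (J : finType) (Q : pred J) (y : J -> T).

Definition dirac_mean (A : set T) : \bar R :=
  (#|Q|%:R^-1)%:E * \sum_(j | Q j) \d_(y j) A.

Let dirac_mean0 : dirac_mean set0 = 0.
Proof. by rewrite /dirac_mean big1 ?mule0// => j _; rewrite dirac0. Qed.

Let dirac_mean_ge0 A : 0 <= dirac_mean A.
Proof.
by rewrite /dirac_mean mule_ge0// ?lee_fin ?invr_ge0// sume_ge0.
Qed.

Let dirac_mean_sigma_additive : semi_sigma_additive dirac_mean.
Proof.
move=> F mF tF mUF; rewrite /dirac_mean.
rewrite [X in X @ _ --> _](_ : _ = fun n => (#|Q|%:R^-1)%:E *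
    \sum_(j | Q j) \sum_(0 <= i < n) \d_(y j) (F i)); last first.
  apply/funext => n; rewrite exchange_big /= ge0_sume_distrr//.
  by move=> i _; rewrite sume_ge0.
apply: cvgeZl => //; apply: cvg_nnesum => j _.
  by apply: nearW => n; rewrite sume_ge0.
exact: measure_semi_sigma_additive.
Qed.

HB.instance Definition _ := isMeasure.Build _ T R dirac_mean
  dirac_mean0 dirac_mean_ge0 dirac_mean_sigma_additive.

Hypothesis Q0 : (0 < #|Q|)%N.

Lemma dirac_meanT : dirac_mean setT = 1.
Proof.
rewrite /dirac_mean (eq_bigr (fun=> 1%:E)); last by move=> j _; rewrite diracT.
rewrite sumEFin -EFinM sumr_const mulVf// pnatr_eq0.
by rewrite -lt0n.
Qed.

Lemma dirac_mean_prob : exists p : probability T R, forall A, p A = dirac_mean A.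
Proof.
pose m := dirac_mean.
pose H := Measure_isProbability.Build _ _ _ m dirac_meanT.
pose p : probability T R := HB.pack m H.
by exists p.
Qed.

End dirac_mean.

(** * Empirical measures as integer weights on the binary tree *)

Section prefix_tree.

Local Lemma tree_le (v : seq bool -> nat) :
  (forall s, v s = v (rcons s true) + v (rcons s false))%N ->
  forall s, (v s <= v [::])%N.
Proof.
move=> vD; elim/last_ind => // s b ih; apply: leq_trans ih; rewrite (vD s).
by case: b; [exact: leq_addr|exact: leq_addl].
Qed.

Lemma mkseq_rcons_eq (b : nat -> bool) n s c : 
  (rcons s c == mkseq b n.+1) = (s == mkseq b n) && (c == b n).
Proof. by rewrite mkseqS eqseq_rcons. Qed.

(* An additive integer weight on the binary tree is carried by finitely many
   infinite branches. *)
Lemma tree_branches (K : nat) (v : seq bool -> nat) :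
  (forall s, v s = v (rcons s true) + v (rcons s false))%N -> v [::] = K ->
  exists p : 'I_K -> nat -> bool,
    forall s, v s = (\sum_(i < K) (s == mkseq (p i) (size s)))%N.
Proof.
elim: K v => [|K ih] v vD v0.
  exists (fun _ _ => false) => s; rewrite big_ord0.
  by apply/eqP; rewrite -leqn0 -v0 tree_le.
(* A branch of positive weight, followed greedily: the child [true] is taken whenever its weight is
   positive; otherwise all the weight of the node is in the child [false]. *)
pose pre := fix pre n := if n is n'.+1 then
   rcons (pre n') (0 < v (rcons (pre n') true))%N else [::].
pose b n := (0 < v (rcons (pre n) true))%N.
have preE n : pre n = mkseq b n.
  by elim: n => [//|n ihn]; rewrite mkseqS -ihn.
have pre0 n : (0 < v (pre n))%N.
  elim: n => [|n ihn]; first by rewrite v0.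
  rewrite [pre n.+1]/=; case E : (0 < v (rcons (pre n) true))%N => //.
  by move: ihn; rewrite vD; move/negbT: E; rewrite -leqNgt leqn0 => /eqP ->.
pose e s := (s == mkseq b (size s)).
have eS s c : e (rcons s c) = e s && (c == b (size s)).
  by rewrite /e size_rcons mkseq_rcons_eq.
have ev s : e s -> (0 < v (rcons s (b (size s))))%N.
  by move=> /eqP es; have := pre0 (size s).+1; rewrite preE mkseqS -es.
(* One unit is removed along the branch [b]. Exactly one child of a node of the branch is again on
   it, so additivity survives and the total drops to [K]. *)
pose v' s := (v s - e s)%N.
have evs s : (e s <= v s)%N.
  case E : (e s) => //; have := pre0 (size s); rewrite preE.
  by rewrite /e in E; rewrite -(eqP E).
have [s||p pv] := ih v'.
- rewrite /v' !eS; case E : (e s) => /=; last by rewrite !subn0 vD.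
  have := ev _ E; rewrite (vD s); case: (b (size s)) => /= h.
    by rewrite subn0 addnBAC.
  by rewrite subn0 addnBA.
- by rewrite /v' v0 /e /= subn1.
exists (fun i => if unlift ord0 i is Some j then p j else b) => s.
rewrite big_ord_recl unlift_none (eq_bigr (fun i => nat_of_bool (s == mkseq (p i) (size s)))).
  by rewrite -pv /v' -/(e s) subnKC.
by move=> i _; rewrite liftK.
Qed.

End prefix_tree.

Section empirical_measures.
Context (R : realType) (T : ptopologicalType) (U : nat -> set T).
Hypothesis bU : countable_basis U.

(** The code of a point records which basic open sets contain it; points with the same code are not
    separated by any Borel set. *)
Let code (z : T) (n : nat) : bool := z \in U n.

Let cell (s : seq bool) : set T := [set z | s == mkseq (code z) (size s)].

Let cell_rcons s c : cell (rcons s c) = cell s `&` [set z | c == code z (size s)].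
Proof.
apply/seteqP; split => z; rewrite /cell /= size_rcons mkseq_rcons_eq.
  by move=> /andP[].
by move=> [-> ->].
Qed.

Let measurable_cell s : measurable (cell s : set (borel T)).
Proof.
elim/last_ind: s => [|s c ih].
  by rewrite (_ : cell _ = setT)//; apply/seteqP; split.
rewrite cell_rcons; apply: measurableI => //.
have mU : measurable (U (size s) : set (borel T)) by apply: open_borel; exact: bU.1.
case: c.
  rewrite (_ : [set _ | _] = U (size s))//.
  apply/seteqP; split => z /=; rewrite /code; first by move=> /eqP/esym/set_mem.
  by move=> Uz; rewrite mem_set.
rewrite (_ : [set _ | _] = ~` U (size s)); first exact: measurableC.
apply/seteqP; split => z /=; rewrite /code.
  by move=> /eqP/esym h Uz; rewrite mem_set in h.
by move=> Uz; rewrite memNset.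
Qed.

(** Two cells are nested or disjoint according to whether one word is a prefix of the other; with
    the empty set added they form a pi-system. *)
Let cellI s t : (size s <= size t)%N -> cell s `&` cell t = if s == take (size s) t then cell t
    else set0.
Proof.
move=> st.
have tk (f : nat -> bool) : take (size s) (mkseq f (size t)) = mkseq f (size s).
  by rewrite /mkseq -map_take take_iota (minn_idPl st).
case: eqP => [E|nE].
  apply/seteqP; split => [z []//|z zt]; split => //.
  by move: zt; rewrite /cell /= => /eqP tz; rewrite {1}E {1}tz tk.
apply/seteqP; split => // z [/eqP zs /eqP zt]; apply: nE.
by rewrite {1}zt tk; exact: zs.
Qed.

Let cells : set (set T) := [set A | A = set0 \/ exists s, A = cell s].

Let cells_setI : setI_closed cells.
Proof.
have H s t : (size s <= size t)%N -> cells (cell s `&` cell t).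
  by move=> st; rewrite cellI//; case: ifP => _; [right; exists t|left].
move=> A B [->|[s ->]]; first by move=> _; left; rewrite set0I.
move=> [->|[t ->]]; first by left; rewrite setI0.
by have [/H//|/ltnW/H] := leqP (size s) (size t); rewrite setIC.
Qed.

Let borel_cells : @measurable _ (borel T) = <<s cells >>.
Proof.
apply/seteqP; split; apply: smallest_sub => //.
- move=> O oO.
  have mUn n : <<s cells >> (U n).
    rewrite (_ : U n = \bigcup_(s in [set s | size s = n.+1 /\ nth false s n]) cell s).
      rewrite bigcup_mkcond.
      apply: (@countable_bigcupT_measurable _ (g_sigma_algebraType cells)) => // s.
      case: ifP => _; last exact: (@measurable0 _ (g_sigma_algebraType cells)).
      by apply: sub_sigma_algebra; right; exists s.
    apply/seteqP; split => z.
      move=> Uz; exists (mkseq (code z) n.+1); last by rewrite /cell /mkset size_mkseq.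
      by split; [rewrite size_mkseq|rewrite nth_mkseq// /code mem_set].
    move=> [s [/= sn sn']]; rewrite /cell /= => /eqP zs; move: sn'.
    by rewrite zs nth_mkseq ?sn// => /set_mem.
  rewrite (_ : O = \bigcup_n (if `[< U n `<=` O >] then U n else set0)).
    apply: (@bigcupT_measurable _ (g_sigma_algebraType cells)) => n.
    by case: asboolP => _; [exact: mUn|exact: (@measurable0 _ (g_sigma_algebraType cells))].
  apply/seteqP; split => x.
    move=> Ox; have [n [Unx UnO]] := bU.2 _ _ oO Ox.
    by exists n => //; case: asboolP.
  by move=> [n _]; case: asboolP => // h; exact: h.
- exact: sigma_algebra_measurable.
- move=> A [->|[s ->]]; [exact: measurable0|exact: measurable_cell].
Qed.

Definition is_empirical k (mu : Prob T R) (x : 'I_k -> T) :=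
  forall A : set (borel T), measurable A -> mu A = @empirical T R k x A.

Lemma empiricalE k (x : 'I_k -> T) (A : set (borel T)) :
  @empirical T R k x A = ((k%:R^-1 * (\sum_(n < k) (x n \in A))%:R)%:E : \bar R).
Proof.
rewrite /empirical (eq_bigr (fun n => ((x n \in A)%:R)%:E)).
  by rewrite sumEFin -EFinM natr_sum.
by move=> n _; rewrite diracE.
Qed.

Lemma empirical_prob k (x : 'I_k -> T) : (0 < k)%N ->
  exists p : Prob T R, is_empirical p x.
Proof.
move=> k0; have c0 : (0 < #|(predT : pred 'I_k)|)%N by rewrite card_ord.
have [p pE] := @dirac_mean_prob _ (borel T) R _ predT x c0.
exists p => A mA; rewrite pE /dirac_mean /empirical.
by rewrite card_ord.
Qed.

(* Membership involves only the countably many cells, which makes the set of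
   empirical measures of [k] points measurable. *)
Lemma is_empiricalP k (mu : Prob T R) : (0 < k)%N ->
  (exists x : 'I_k -> T, is_empirical mu x) <->
  (forall s, exists m : 'I_k.+1, mu (cell s) = (k%:R^-1 * (m : nat)%:R)%:E).
Proof.
move=> k0; have kR : (k%:R : R) != 0 by rewrite pnatr_eq0 -lt0n.
have kV0 : 0 < (k%:R^-1 : R) by rewrite invr_gt0 ltr0n.
split.
  move=> [x xE] s; rewrite xE; last exact: (measurable_cell s).
  rewrite empiricalE.
  have h : (\sum_(n < k) (x n \in cell s) < k.+1)%N.
    rewrite ltnS -[X in (_ <= X)%N]card_ord -sum1_card; apply: leq_sum => i _.
    exact: leq_b1.
  by exists (Ordinal h).
move=> /choice[v vE].
have vinj m m' : (k%:R^-1 * m%:R)%:E = (k%:R^-1 * m'%:R)%:E :> \bar R -> m = m'.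
  by move=> [] /(mulfI (lt0r_neq0 kV0))/eqP; rewrite eqr_nat => /eqP.
have vD s : (v s = v (rcons s true) + v (rcons s false) :> nat)%N.
  apply: vinj; rewrite natrD mulrDr EFinD -!vE -measureU; [|exact: measurable_cell..|].
    congr (mu _); rewrite !cell_rcons -setIUr; apply/seteqP; split => z; last by case.
    by move=> zs; split => //=; case: (code z _); [left|right].
  rewrite !cell_rcons; apply/seteqP; split => // z [] [_ /= /eqP h1] [_ /= /eqP].
  by rewrite -h1.
have v0 : v [::] = k :> nat.
  apply: vinj; rewrite -vE mulVf// (_ : cell [::] = setT) ?probability_setT//.
  by apply/seteqP; split.
have [p pv] := tree_branches vD v0.
(* Every cell along the branch [p i] has mass at least [1/k], hence so has their intersection by
   continuity from above, and it contains a point. *)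
have ne i : exists z, forall n, cell (mkseq (p i) n) z.
  pose F n : set (borel T) := cell (mkseq (p i) n).
  have mF n : measurable (F n) by exact: measurable_cell.
  have cvF : mu (F n) @[n --> \oo] --> mu (\bigcap_n F n).
    apply: nonincreasing_cvg_mu => //.
    - by rewrite ltey_eq fin_num_measure.
    - exact: bigcapT_measurable.
    - apply/nonincreasing_seqP => n; apply/subsetPset.
      by rewrite /F mkseqS cell_rcons; exact: subIsetl.
  have : (k%:R^-1%:E <= mu (\bigcap_n F n))%E.
    rewrite -(cvg_lim _ cvF)//; apply: lime_ge; first by apply/cvg_ex; eexists; exact: cvF.
    apply: nearW => n; rewrite vE lee_fin; apply: ler_peMr; first exact: ltW.
    rewrite ler1n pv.
    by rewrite (bigD1 i)//= size_mkseq eqxx.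
  have [->|/set0P[z Fz _]] := eqVneq (\bigcap_n F n) set0.
    by rewrite measure0 leNgt lte_fin kV0.
  by exists z => n; exact: Fz.
have [x xp] := choice ne; exists x.
(* The chosen [x i] has code [p i], so [mu] and the empirical measure of [x] agree on every cell,
   and the cells generate the Borel sets. *)
have [q qE] := empirical_prob x k0.
move=> A mA; rewrite -qE//.
apply: (pi_system_eq borel_cells cells_setI) mA => _ [->|[s ->]].
  by rewrite !measure0.
rewrite qE; last exact: (measurable_cell s).
rewrite vE empiricalE pv; congr (_ * _%:R)%:E; apply: eq_bigr => i _.
have xpi n : code (x i) n = p i n.
  have := xp i n.+1; rewrite /cell /mkset size_mkseq => /eqP E.
  have := congr1 (fun s => nth false s n) E; by rewrite !nth_mkseq.
have E m : mkseq (code (x i)) m = mkseq (p i) m by apply: eq_mkseq.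
congr nat_of_bool; apply/idP/idP.
  by move=> h; apply/mem_set; rewrite /cell /= E.
by move=> /set_mem; rewrite /cell /= E.
Qed.

Lemma measurable_is_empirical k : (0 < k)%N ->
  (forall A : set (borel T), measurable A ->
    measurable_fun [set: probW R T] (fun nu : probW R T => (nu : Prob T R) A)) ->
  measurable ([set mu | exists x : 'I_k -> T, is_empirical mu x] : set (probW R T)).
Proof.
move=> k0 mev.
rewrite (_ : [set mu | _] = \bigcap_(s : seq bool) \bigcup_(m : 'I_k.+1)
    [set mu : probW R T | (mu : Prob T R) (cell s) = (k%:R^-1 * (m : nat)%:R)%:E]).
  rewrite -[X in measurable X]setCK setC_bigcap; apply: measurableC.
  apply: countable_bigcupT_measurable => // s; apply: measurableC.
  apply: countable_bigcupT_measurable => // m.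
  rewrite -[X in measurable X]setTI.
  have := mev _ (measurable_cell s) measurableT [set (k%:R^-1 * (m : nat)%:R)%:E].
  by apply; exact: emeasurable_set1.
apply/seteqP; split => mu.
  move=> /(is_empiricalP mu k0) h s _; have [m mE] := h s.
  by exists m.
move=> h; apply/(is_empiricalP mu k0) => s.
by have [m _ mE] := h s Logic.I; exists m.
Qed.

End empirical_measures.

Section sampling_without_replacement.
Context (R : realType) (T : ptopologicalType) (k : nat).
Local Notation sT := (seq_space T (Some k)).

Lemma lambdaNk_prob (x : 'I_k -> T) :
  exists p : Prob sT R, forall A, p A = @lambdaNk T R k k x A.
Proof.
pose Q : pred {ffun 'I_k -> 'I_k} := fun f => injectiveb f.
have cQ : #|Q| = (k ^_ k)%N.
  have := card_inj_ffuns 'I_k 'I_k; rewrite !card_ord => <-.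
  by apply: eq_card => f; rewrite inE.
have Q0 : (0 < #|Q|)%N by rewrite cQ ffactnn fact_gt0.
have [p pE] := @dirac_mean_prob _ (borel sT) R _ Q (fun f => (fun j => x (f j)) : sT) Q0.
by exists p => A; rewrite pE /dirac_mean cQ.
Qed.

Let type (A : 'I_k -> set (borel T)) (z : T) : {ffun 'I_k -> bool} :=
  [ffun j => z \in A j].

Let atom A (t : {ffun 'I_k -> bool}) : set (borel T) := [set z | type A z == t].

Let measurable_atom A t : (forall j, measurable (A j)) -> measurable (atom A t).
Proof.
move=> mA.
rewrite (_ : atom A t = \big[setI/setT]_(j : 'I_k) (if t j then A j else ~` A j)).
  by apply: bigsetI_measurable => j _; case: ifP => _ //; exact: measurableC.
rewrite -bigcap_seq; apply/seteqP; split => z.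
  move=> /eqP <- j _ /=; rewrite ffunE.
  by case: (boolP (z \in A j)) => [/set_mem//|nz] zA; move/negP: nz; apply; exact/mem_set.
move=> h; apply/eqP/ffunP => j; rewrite ffunE.
have := h j; rewrite /= mem_index_enum => /(_ isT).
by case: (t j) => zA; [rewrite mem_set|rewrite memNset].
Qed.

(** Equal masses of the atoms mean that [x] and [y] have the same number of points of each type, so
    a permutation [g] matches the types. Composing the injective maps with [g] only reindexes the
    sum. *)
Lemma lambdaNk_rect (A : 'I_k -> set (borel T)) (x y : 'I_k -> T) :
  (0 < k)%N ->
  (forall t, @empirical T R k x (atom A t) = @empirical T R k y (atom A t)) ->
  @lambdaNk T R k k x [set z | forall j, A j (z j)] =
  @lambdaNk T R k k y [set z | forall j, A j (z j)].
Proof.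
move=> k0 xy; have kR : (k%:R^-1 : R) != 0 by rewrite invr_eq0 pnatr_eq0 -lt0n.
have cnt t (u : 'I_k -> T) :
    (\sum_(n < k) (u n \in atom A t))%N = count_mem t [tuple type A (u n) | n < k].
  rewrite -sum1_count big_map big_enum_cond /= [RHS]big_mkcond /=.
  apply: eq_bigr => n _.
  have -> : (u n \in atom A t) = (type A (u n) == t).
    by apply/idP/idP => [/set_mem//|h]; exact/mem_set.
  by case: eqP.
have pq : perm_eq [tuple type A (x n) | n < k] [tuple type A (y n) | n < k].
  rewrite /perm_eq; apply/allP => t _; apply/eqP; rewrite -!cnt.
  have := xy t; rewrite !empiricalE => -[] /(mulfI kR)/eqP.
  by rewrite eqr_nat => /eqP.
have /tuple_permP[g E] := pq.
have txy n j : (x n \in A j) = (y (g n) \in A j).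
  have := congr1 (fun s => nth [ffun=> false] s n) E.
  rewrite -!tnth_nth !tnth_mktuple => /ffunP/(_ j).
  by rewrite !ffunE.
rewrite /lambdaNk; congr (_ * _)%E.
pose h (f : {ffun 'I_k -> 'I_k}) : {ffun 'I_k -> 'I_k} := [ffun j => g (f j)].
have bh : bijective h.
  exists (fun f : {ffun 'I_k -> 'I_k} => [ffun j => (g^-1)%g (f j)]) => f.
    by apply/ffunP => j; rewrite !ffunE permK.
  by apply/ffunP => j; rewrite !ffunE permKV.
rewrite [RHS](reindex h) /=; last exact: onW_bij.
have hinj f : injectiveb (h f) = injectiveb f.
  apply/injectiveP/injectiveP => fi i j ij; apply: fi.
    by rewrite !ffunE ij.
  by move: ij; rewrite !ffunE => /perm_inj.
rewrite [RHS](eq_bigl _ _ hinj); apply: eq_bigr => f _.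
rewrite !diracE; congr ((nat_of_bool _)%:R%:E).
have H : [set z : sT | forall j, A j (z j)] (fun j => x (f j)) =
    [set z : sT | forall j, A j (z j)] (fun j => y (h f j)).
  apply/propext; split => H j; have /mem_set := H j; rewrite ?ffunE.
    by rewrite txy => /set_mem.
  by rewrite -txy => /set_mem.
have [zin|znin] := pselect ([set z : sT | forall j, A j (z j)] (fun j => x (f j))).
  by rewrite !mem_set// -H.
by rewrite !memNset// -H.
Qed.

Variable U : nat -> set T.
Hypothesis bU : countable_basis U.
Hypothesis k0 : (0 < k)%N.

(** The configuration is picked arbitrarily; [sampling_kernelE] shows that any other one with the
    same empirical measure gives the same law. Measures that are not empirical all get the same
    default [point]. *)
Definition sampling_kernel (mu : Prob T R) : Prob sT R :=
  if pselect (exists x : 'I_k -> T, is_empirical mu x) is left h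
  then projT1 (cid (lambdaNk_prob (projT1 (cid h)))) else point.

Let borel_rects : @measurable _ (borel sT) = <<s rects (fun _ : 'I_k => borel T) >>.
Proof. exact: (@borel_prod_rects 'I_k (fun _ => T) (fun _ => U)). Qed.

Let rectsI : setI_closed (rects (fun _ : 'I_k => borel T) : set (set (borel sT))).
Proof. exact: (@rects_setI 'I_k _ (fun _ => borel T)). Qed.

Lemma sampling_kernelE (mu : Prob T R) x : is_empirical mu x ->
  forall A, measurable A -> sampling_kernel mu A = @lambdaNk T R k k x A.
Proof.
move=> ex A mA; rewrite /sampling_kernel; case: pselect => [h|]; last by case; exists x.
case: cid => y ey /=; case: cid => p pE /=.
have [q qE] := lambdaNk_prob x; rewrite -qE.
apply: (@pi_system_eq _ (borel sT) R _ borel_rects rectsI p q) mA => _ [s [B [us mB BT ->]]].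
rewrite pE qE rectT//; apply: lambdaNk_rect => // t.
by rewrite -ex ?ey//; exact: measurable_atom.
Qed.

(* On empirical measures, the kernel of a rectangle only depends on the masses of
   the atoms of the algebra generated by its sides, which take finitely many values. *)
Lemma measurable_sampling_kernel :
  (forall A : set (borel T), measurable A ->
    measurable_fun [set: probW R T] (fun nu : probW R T => (nu : Prob T R) A)) ->
  forall A, measurable A ->
  measurable_fun [set: probW R T] (fun nu : probW R T => sampling_kernel nu A).
Proof.
move=> mev; apply: (@pi_system_measurable _ (borel sT) R _ borel_rects rectsI _ (probW R T)
    sampling_kernel) => _ [s [B [us mB BT ->]]].
pose E : set (probW R T) := [set mu | exists x : 'I_k -> T, is_empirical mu x].
have mE : measurable E by exact: (measurable_is_empirical bU k0 mev).
move=> _ Y mY; rewrite setTI.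
(* [c] lists the numbers of points in the atoms. By [lambdaNk_rect] these counts alone decide
   whether the value falls in [Y], so one realising configuration [x] is enough, and the preimage is
   a finite union over [c]. *)
pose good (c : {ffun {ffun 'I_k -> bool} -> 'I_k.+1}) := `[< exists x : 'I_k -> T,
  (forall t, @empirical T R k x (atom B t) = (k%:R^-1 * (c t : nat)%:R)%:E) /\
  Y (@lambdaNk T R k k x (rect s B)) >].
pose M (c : {ffun {ffun 'I_k -> bool} -> 'I_k.+1}) : set (probW R T) :=
  if good c then \bigcap_(t : {ffun 'I_k -> bool})
    [set mu : probW R T | (mu : Prob T R) (atom B t) = (k%:R^-1 * (c t : nat)%:R)%:E] else set0.
have mM c : measurable (M c).
  rewrite /M; case: ifP => // _.
  rewrite -[X in measurable X]setCK setC_bigcap; apply: measurableC.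
  apply: countable_bigcupT_measurable => // t; apply: measurableC.
  rewrite -[X in measurable X]setTI.
  have := mev _ (measurable_atom t mB) measurableT [set (k%:R^-1 * (c t : nat)%:R)%:E].
  by apply; exact: emeasurable_set1.
have mR : measurable (rect s B : set (borel sT)).
  rewrite borel_rects; apply: sub_sigma_algebra; by exists s, B.
rewrite (_ : _ @^-1` Y = (E `&` \bigcup_c M c) `|`
    (~` E `&` (if `[< Y ((point : Prob sT R) (rect s B)) >] then setT else set0))).
  apply: measurableU.
    by apply: measurableI => //; exact: countable_bigcupT_measurable.
  by apply: measurableI; [exact: measurableC|case: ifP].
apply/seteqP; split => mu.
  move=> /= Ymu; have [[x xE]|nE] := pselect (E mu).
    left; split; first by exists x.
    have lt (t : {ffun 'I_k -> bool}) : (\sum_(n < k) (x n \in atom B t) < k.+1)%N.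
      rewrite ltnS -[X in (_ <= X)%N]card_ord -sum1_card; apply: leq_sum => i _.
      exact: leq_b1.
    pose c : {ffun {ffun 'I_k -> bool} -> 'I_k.+1} := [ffun t => Ordinal (lt t)].
    exists c => //; rewrite /M.
    have -> : good c.
      apply/asboolP; exists x; split => [t|].
        by rewrite empiricalE ffunE.
      by rewrite -(sampling_kernelE xE).
    by move=> t _ /=; rewrite xE ?empiricalE ?ffunE//; exact: measurable_atom.
  right; split => //; move: Ymu; rewrite /sampling_kernel.
  by case: pselect => // _ Ymu; case: asboolP.
move=> [[[x xE] [c _]]|[nE]].
  rewrite /M; case: ifPn => // /asboolP[y [yc Yy]] muc /=.
  rewrite (sampling_kernelE xE)//; move: Yy; rewrite !rectT//.
  rewrite (@lambdaNk_rect B y x)// => t.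
  by rewrite yc -xE ?muc//; exact: measurable_atom.
rewrite /= /sampling_kernel; case: pselect => // _.
by case: asboolP.
Qed.

End sampling_without_replacement.

(** [prodM] and [borel (prod_topology T)] are distinct measurable types whose sigma-algebras agree
    by [borel_prod]; the same set function is packaged again on the second one. *)
Lemma borel_product_measure (R : realType) (I : countType) (T : I -> ptopologicalType)
    (U : forall i, nat -> set (T i)) (mu : forall i, Prob (T i) R) :
  (forall i, countable_basis (U i)) ->
  exists K : Prob (prod_topology T) R, forall s (A : forall i, set (borel (T i))),
    uniq s -> (forall i, measurable (A i)) ->
    K (rect s A) = (\prod_(i <- s) mu i (A i))%E.
Proof.
move=> bU; pose m : set (borel (prod_topology T)) -> \bar R :=
  fun A => prod_measure (T := fun i => borel (T i)) mu A.
have m0 : m set0 = 0%E by rewrite /m measure0.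
have mge0 A : (0 <= m A)%E by exact: measure_ge0.
have ms : semi_sigma_additive m.
  move=> F mF tF mUF.
  apply: (@measure_semi_sigma_additive _ _ _ (prod_measure (T := fun i => borel (T i)) mu)) => //.
    by move=> n; have := mF n; rewrite (borel_prod bU).
  by move: mUF; rewrite (borel_prod bU).
have m1 : m setT = 1%E by exact: (probability_setT (prod_measure (T := fun i => borel (T i)) mu)).
pose H1 := isMeasure.Build _ _ _ m m0 mge0 ms.
pose M : {measure set (borel (prod_topology T)) -> \bar R} := HB.pack m H1.
pose H2 := Measure_isProbability.Build _ _ _ M m1.
pose K : Prob (prod_topology T) R := HB.pack m H1 H2.
exists K => s A us mA.
exact: (prod_measure_rect (T := fun i => borel (T i)) mu).
Qed.

(** * Measurable kernels for a single class *)

Section class_kernel.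
Context (R : realType) (T : completePseudoMetricType R) (U : nat -> set T).
Hypothesis bU : countable_basis U.

Lemma seq_space_countable_basis o : exists V : nat -> set (seq_space T o), countable_basis V.
Proof.
case: o => [k|].
  exact: (@countable_basis_prod_ex 'I_k (fun _ => T) (fun _ => U)).
exact: (@countable_basis_prod_ex nat (fun _ => T) (fun _ => U)).
Qed.

Lemma measurable_seq_coord o (n : Idx o) :
  measurable_fun [set: borel (seq_space T o)] ((fun z => z n) : borel (seq_space T o) -> borel T).
Proof.
case: o n => [k|] n; first exact: (@measurable_proj 'I_k (fun _ => T) n).
exact: (@measurable_proj nat (fun _ => T) n).
Qed.

Lemma measurable_fun_seq d (Z : measurableType d) o (f : Z -> seq_space T o) :
  (forall n, measurable_fun [set: Z] ((fun z => f z n) : Z -> borel T)) ->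
  measurable_fun [set: Z] (f : Z -> borel (seq_space T o)).
Proof.
case: o f => [k|] f mf.
  exact: (@measurable_fun_prod _ Z 'I_k (fun _ => T) (fun _ => U)).
exact: (@measurable_fun_prod _ Z nat (fun _ => T) (fun _ => U)).
Qed.

Lemma measurable_prode d (Z : measurableType d) (J : Type) (s : seq J) (f : J -> Z -> \bar R) :
  (forall j, measurable_fun [set: Z] (f j)) ->
  measurable_fun [set: Z] (fun z => \prod_(j <- s) f j z)%E.
Proof.
move=> mf; elim: s => [|j s ih].
  by under eq_fun do rewrite big_nil; exact: measurable_cst.
under eq_fun do rewrite big_cons; exact: emeasurable_funM.
Qed.

Definition finite_class_cond o : (Idx o -> T) -> Prob T R -> Prop :=
  match o return (Idx o -> T) -> Prob T R -> Prop with
  | Some k => fun x lam => is_empirical lam x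
  | None => fun _ _ => True
  end.

(** For an infinite class the required law is the infinite power of [lam], whatever the
    configuration; for a finite one [lam] must be the empirical measure of [x], which is what
    [finite_class_cond] records. *)
Lemma class_kernel o : (forall k, o = Some k -> (0 < k)%N) ->
  exists F : Prob T R -> Prob (seq_space T o) R,
    (forall A, measurable A ->
       measurable_fun [set: probW R T] (fun mu : probW R T => F mu A)) /\
    (forall x lam, @finite_class_cond o x lam -> class_law x lam (F lam)).
Proof.
have mev := @measurable_ev R T.
case: o => [k|] ok.
  have k0 : (0 < k)%N by exact: ok.
  exists (@sampling_kernel R T k); split; last first.
    by move=> x lam xlam A mA; exact: (sampling_kernelE bU k0 xlam).
  exact: (measurable_sampling_kernel bU k0).
have brects : @measurable _ (borel (seq_space T None)) = <<s rects (fun _ : nat => borel T) >>.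
  exact: (@borel_prod_rects nat (fun _ => T) (fun _ => U)).
have rI : setI_closed (rects (fun _ : nat => borel T) : set (set (borel (seq_space T None)))).
  exact: (@rects_setI nat _ (fun _ => borel T)).
have /choice[F FE] : forall mu : Prob T R, exists K : Prob (seq_space T None) R,
    forall s (A : nat -> set (borel T)), uniq s -> (forall i, measurable (A i)) ->
    K (rect s A) = (\prod_(i <- s) mu (A i))%E.
  move=> mu.
  exact: (@borel_product_measure R nat (fun _ => T) (fun _ => U) (fun _ => mu)).
exists F; split.
  apply: (@pi_system_measurable _ (borel (seq_space T None)) R _ brects rI _ (probW R T) F) => _
      [s [A [us mA AT ->]]].
  under eq_fun do rewrite FE//.
  by apply: measurable_prode => n; exact: mev.
move=> x lam _ m A mA.
(* The sides are extended from ['I_m] to all of [nat], the proof of [n < m] being needed to form the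
   ordinal. *)
pose B n : set (borel T) := if @idP (n < m)%N is ReflectT h then A (Ordinal h) else setT.
have BE (j : 'I_m) : B j = A j.
  rewrite /B; case: {-}_ / idP => [h|]; last by rewrite ltn_ord.
  by congr A; exact: val_inj.
have mB n : measurable (B n) by rewrite /B; case: {-}_ / idP.
rewrite (_ : [set y | _] = rect (index_iota 0 m) B).
  rewrite FE ?iota_uniq// big_mkord.
  by apply: eq_bigr => j _; rewrite BE.
apply/seteqP; split => y /= h.
  move=> n; rewrite mem_index_iota /= => nm.
  by have := h (Ordinal nm); rewrite -(BE (Ordinal nm)).
by move=> j; rewrite -BE; apply: h; rewrite mem_index_iota /=.
Qed.

End class_kernel.

(** * Exchangeable systems *)

Section pull_out.
Local Open Scope ereal_scope.
Context d (Om : measurableType d) (R : realType) (P : probability Om R)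
  d' (Z : measurableType d') (D1 D2 : set Om) (phi1 phi2 : Om -> Z) (v : Om -> \bar R).
Hypothesis mD1 : measurable D1.
Hypothesis mD2 : measurable D2.
Hypothesis mphi1 : measurable_fun [set: Om] phi1.
Hypothesis mphi2 : measurable_fun [set: Om] phi2.
Hypothesis mv : measurable_fun [set: Om] v.
Hypothesis v0 : forall w, 0 <= v w.
Hypothesis vfin : forall w, v w \is a fin_num.
Hypothesis Pv : forall A, measurable A ->
  P (D1 `&` phi1 @^-1` A) = \int[P]_(w in D2 `&` phi2 @^-1` A) v w.

Import HBNNSimple.

(** [Pv] equates two measures on [Z]: the image under [phi1] of [P] on [D1], and the image under
    [phi2] of [P] on [D2] with density [v]. Simple functions and monotone convergence carry the
    equality over to [g]. It is used with [v = 1] for equal laws and with [phi1 = phi2 = id] into a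
    coarser sigma-algebra. *)
Lemma pull_out (g : Z -> \bar R) : measurable_fun [set: Z] g -> (forall z, 0 <= g z) ->
  \int[P]_(w in D1) g (phi1 w) = \int[P]_(w in D2) (g (phi2 w) * v w).
Proof.
move=> mg g0.
pose h := nnsfun_approx measurableT mg.
have mpre1 A : measurable A -> measurable (phi1 @^-1` A).
  by move=> mA; rewrite -[X in measurable X]setTI; exact: mphi1.
have mpre2 A : measurable A -> measurable (phi2 @^-1` A).
  by move=> mA; rewrite -[X in measurable X]setTI; exact: mphi2.
have mI1 B : measurable B -> measurable_fun [set: Om] (fun w => \1_B (phi1 w) : R).
  move=> mB; have := measurableT_comp (@measurable_indic _ Z R setT B mB) mphi1.
  exact.
have mI2 B : measurable B -> measurable_fun [set: Om] (fun w => \1_B (phi2 w) : R).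
  move=> mB; have := measurableT_comp (@measurable_indic _ Z R setT B mB) mphi2.
  exact.
have hE n : \int[P]_(w in D1) (h n (phi1 w))%:E = \int[P]_(w in D2) ((h n (phi2 w))%:E * v w).
  under eq_integral do rewrite fimfunE -fsumEFin//.
  rewrite ge0_integral_fsum//; last 2 first.
  - move=> r; apply/measurable_EFinP; apply: measurable_funM => //.
    by apply: measurable_funTS; exact: mI1.
  - by move=> r w _; rewrite EFinM nnfun_muleindic_ge0.
  rewrite [RHS](_ : _ = \int[P]_(w in D2) \sum_(r \in range (h n)) ((r * \1_(h n @^-1` [set r])
      (phi2 w))%:E * v w)); last first.
    apply: eq_integral => w _; rewrite fimfunE -fsumEFin//.
    by rewrite ge0_mule_fsuml// => r; rewrite EFinM nnfun_muleindic_ge0.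
  have mi r : measurable_fun [set: Om] (fun w => (r * \1_(h n @^-1` [set r]) (phi2 w))%:E * v w).
    apply: emeasurable_funM => //; apply/measurable_EFinP; apply: measurable_funM => //.
    exact: mI2.
  rewrite [RHS]ge0_integral_fsum//; last 2 first.
  - by move=> r; exact: measurable_funTS.
  - by move=> r w _; rewrite mule_ge0// EFinM nnfun_muleindic_ge0.
  apply: eq_fsbigr => r /set_mem[z _ hz].
  have r0 : (0 <= r)%R by rewrite -hz; exact: fun_ge0.
  pose B := h n @^-1` [set r].
  have mB : measurable B by exact: measurable_sfunP.
  rewrite (eq_integral (fun w => r%:E * (\1_(phi1 @^-1` B) w)%:E)); last by move=> w _; rewrite
      -EFinM.
  rewrite ge0_integralZl_EFin//; last first.
    by apply/measurable_EFinP; apply: measurable_indic; exact: mpre1.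
  rewrite integral_indic//; last exact: mpre1.
  rewrite [X in _ * X](_ : _ = \int[P]_(w in D2 `&` phi2 @^-1` B) v w); last first.
    by rewrite setIC; exact: Pv.
  rewrite integral_mkcondr.
  rewrite -ge0_integralZl_EFin//; last 2 first.
  - by move=> w _; rewrite patchE; case: ifP.
  - apply: measurable_funTS; apply/(measurable_restrictT _ _).1 => //; first exact: mpre2.
    exact: measurable_funTS.
  apply: eq_integral => w _; rewrite patchE EFinM -muleA; congr (_ * _).
  rewrite indicE; have [/set_mem wB|wB] := boolP (w \in phi2 @^-1` B).
    by rewrite mem_set// mul1e.
  rewrite memNset ?mul0e// => hw; move/negP: wB; apply; exact/mem_set.
have mh1 n : measurable_fun D1 (fun w => (h n (phi1 w))%:E).
  by apply/measurable_EFinP; apply: measurable_funTS; apply: measurableT_comp.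
have mh2 n : measurable_fun D2 (fun w => (h n (phi2 w))%:E * v w).
  apply: measurable_funTS; apply: emeasurable_funM => //.
  by apply/measurable_EFinP; apply: measurableT_comp.
have nd z : nondecreasing_seq (fun n => (h n z)%:E).
  by move=> n m nm; rewrite lee_fin; exact/lefP/nd_nnsfun_approx.
have cvh z : (h n z)%:E @[n --> \oo] --> g z.
  exact: (cvg_nnsfun_approx measurableT mg (fun z _ => g0 z) I).
have L1 := @cvg_monotone_convergence _ _ _ P _ mD1 (fun n w => (h n (phi1 w))%:E) mh1.
have {L1} : \int[P]_(w in D1) (h n (phi1 w))%:E @[n --> \oo] --> \int[P]_(w in D1) g (phi1 w).
  rewrite [X in _ --> X](_ : _ = \int[P]_(w in D1) limn (fun n => (h n (phi1 w))%:E)); last first.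
    by apply: eq_integral => w _; apply/esym/cvg_lim.
  apply: L1 => [n w _|w _]; first by rewrite lee_fin.
  exact: nd.
have L2 := @cvg_monotone_convergence _ _ _ P _ mD2 (fun n w => (h n (phi2 w))%:E * v w) mh2.
have {L2} : \int[P]_(w in D2) ((h n (phi2 w))%:E * v w) @[n --> \oo] -->
    \int[P]_(w in D2) (g (phi2 w) * v w).
  rewrite [X in _ --> X](_ : _ = \int[P]_(w in D2) limn (fun n => (h n (phi2 w))%:E * v w));
      last first.
    apply: eq_integral => w _; apply/esym/cvg_lim => //.
    by apply: cvgeZr => //; exact: cvh.
  apply: L2 => [n w _|w _]; first by rewrite mule_ge0// lee_fin.
  by move=> n m nm; apply: lee_wpmul2r => //; exact: nd.
under eq_cvg do rewrite -hE.
move=> c2 c1; exact: cvg_unique c1 c2.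
Qed.

End pull_out.

Section exchangeable_class.
Local Open Scope ereal_scope.
Context d (Om : measurableType d) (R : realType) (P : probability Om R)
  (T : completePseudoMetricType R) (U : nat -> set T).
Hypothesis bU : countable_basis U.

Lemma ae_iff_measure (A B : set Om) : measurable A -> measurable B ->
  {ae P, forall w, A w <-> B w} -> P A = P B.
Proof.
move=> mA mB AB.
rewrite -[A]setIT -[B]setIT -!integral_indic//.
apply: ge0_ae_eq_integral => //.
- by apply/measurable_EFinP; exact: measurable_indic.
- by apply/measurable_EFinP; exact: measurable_indic.
apply: filterS AB => w ABw _; rewrite !indicE; congr ((nat_of_bool _)%:R%:E).
by apply/idP/idP => /set_mem h; apply/mem_set/ABw.
Qed.

(* The law of [x n] on [D] is the same for all large [n], so it equals the
   Cesaro limit of these laws, which is the integral of [lam] over [D]. *)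
Lemma exch_coord (x : nat -> Om -> T) (lam : Om -> Prob T R) (D : set Om) (l m : nat) :
  (forall n, measurable_fun [set: Om] (x n : Om -> borel T)) ->
  measure_vector_comp (o := None) P x lam -> measurable D ->
  (forall A : set (borel T), measurable A -> measurable_fun [set: Om] (fun w => lam w A)) ->
  (forall n (B : set (borel T)), (m <= n)%N -> measurable B ->
     P (D `&` x n @^-1` B) = P (D `&` x l @^-1` B)) ->
  forall B : set (borel T), measurable B ->
    P (D `&` x l @^-1` B) = \int[P]_(w in D) lam w B.
Proof.
move=> mx [_ cvlam] mD mlam exch.
apply: (@pi_system_integral _ (borel T) R (@open T) erefl (@openI T) _ Om P lam (x l) D (mx l)
    mD mlam).
move=> W oW; have [f [cf f01 fW]] := open_approx oW.
have bf p : bcont (f p).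
  split; first exact: cf.
  by exists 1%R => z; have /andP[f0 f1] := f01 p z; rewrite ger0_norm.
have mf p : measurable_fun [set: borel T] (f p : borel T -> R) by exact: continuous_measurable.
have mfx p n : measurable_fun [set: Om] (fun w => f p (x n w)).
  exact: (measurableT_comp (mf p) (mx n)).
have mint p : measurable_fun [set: Om] (fun w => integ (lam w) (f p)).
  have h : measurable_fun [set: Om] (lam : Om -> probW R T).
    move=> _ B mB; rewrite setTI; apply: (measurable_fun_probW bU) mB => O oO.
    by apply: mlam; exact: open_borel.
  exact: (measurableT_comp (measurable_integ (bf p)) h).
have step p : \int[P]_(w in D) (f p (x l w))%:E = \int[P]_(w in D) (integ (lam w) (f p))%:E.
  pose a n := fine (\int[P]_(w in D) (f p (x n w))%:E).
  have aE n : \int[P]_(w in D) (f p (x n w))%:E = (a n)%:E.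
    rewrite /a fineK//; apply: integrable_fin_num => //.
    apply: (@bounded_integrable _ _ _ P D (fun w => f p (x n w)) 1) => //.
      exact: measurable_funTS.
    by move=> w _; have /andP[f0 f1] := f01 p (x n w); rewrite ger0_norm.
  have al n : (m <= n)%N -> a n = a l.
    move=> mn; apply: EFin_inj; rewrite -!aE.
    rewrite (@pull_out _ Om R P _ (borel T) D D (x n) (x l) (cst 1) mD mD (mx n) (mx l) _ _ _ _
        (EFin \o f p)) //=.
    - by under eq_integral do rewrite mule1.
    - move=> A mA; rewrite exch// integral_cst ?mul1e//.
      apply: measurableI => //; rewrite -[X in measurable X]setTI; exact: mx.
    - exact/measurable_EFinP.
    - by move=> z; rewrite lee_fin; have /andP[] := f01 p z.
  have ca : a n @[n --> \oo] --> a l.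
    by apply: cvg_near_cst; near=> n; apply/eqP/eqP/al; near: n; exists m.
  have c1 : (arithmetic_mean a n)%:E @[n --> \oo] --> (a l)%:E.
    by apply: cvg_EFin; [exact: nearW|exact: cesaro].
  have c2 : (arithmetic_mean a n)%:E @[n --> \oo] --> \int[P]_(w in D) (integ (lam w) (f p))%:E.
    rewrite [X in X @ _ --> _](_ : _ = fun n => \int[P]_(w in D)
       (n.+1%:R^-1 * \sum_(i < n.+1) f p (x i w))%:E); last first.
      apply/funext => n.
      under [RHS]eq_integral do rewrite EFinM -sumEFin.
      rewrite ge0_integralZl_EFin//; last 2 first.
      - by move=> w _; rewrite sume_ge0// => i _; rewrite lee_fin; have /andP[] := f01 p (x i w).
      - by apply: emeasurable_sum => i; apply/measurable_EFinP; exact: measurable_funTS.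
      rewrite ge0_integral_sum//; last 2 first.
      - by move=> i; apply/measurable_EFinP; exact: measurable_funTS.
      - by move=> i w _; rewrite lee_fin; have /andP[] := f01 p (x i w).
      rewrite (eq_bigr (fun i : 'I_n.+1 => (a i)%:E)); last by move=> i _; exact: aE.
      by rewrite sumEFin -EFinM /arithmetic_mean /series /= big_mkord.
    apply: (@bounded_cvg_integral _ _ _ P D _ _ 1) => //.
    - move=> n; apply: measurable_funTS; apply: measurable_funM => //.
      by apply: measurable_sum => i.
    - exact: measurable_funTS.
    - move=> n w _.
      have s0 : (0 <= \sum_(i < n.+1) f p (x i w))%R.
        by apply: sumr_ge0 => i _; have /andP[] := f01 p (x i w).
      rewrite ger0_norm ?mulr_ge0// mulrC ler_pdivrMr// mul1r.
      rewrite -[X in (_ <= X%:R)%R]card_ord -sum1_card natr_sum ler_sum// => i _.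
      by have /andP[] := f01 p (x i w).
    - by apply: filterS cvlam => w h _; exact: h.
  by rewrite aE; exact: cvg_unique c1 c2.
have cl : \int[P]_(w in D) (f p (x l w))%:E @[p --> \oo] --> P (D `&` x l @^-1` W).
  have mxW : measurable (x l @^-1` W).
    by rewrite -[X in measurable X]setTI; apply: mx => //; exact: open_borel.
  rewrite setIC -integral_indic//.
  apply: (@bounded_cvg_integral _ _ _ P D _ _ 1) => //.
  - by move=> p; exact: measurable_funTS.
  - by move=> p w _; have /andP[f0 f1] := f01 p (x l w); rewrite ger0_norm.
  - by apply: aeW => w _; exact: fW.
have cr : \int[P]_(w in D) (integ (lam w) (f p))%:E @[p --> \oo] --> \int[P]_(w in D) lam w W.
  rewrite [X in _ --> X](_ : _ = \int[P]_(w in D) (fine (lam w W))%:E); last first.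
    by apply: eq_integral => w _; rewrite fineK// fin_num_measure//; exact: open_borel.
  apply: (@bounded_cvg_integral _ _ _ P D _ _ 1) => //.
  - by move=> p; exact: measurable_funTS.
  - apply: measurable_funTS; apply: (measurableT_comp (fine_measurable _)) => //.
    by apply: mlam; exact: open_borel.
  - by move=> p w _; have /andP[i0 i1] := integ01 (lam w) (bf p) (f01 p); rewrite ger0_norm.
  - apply: aeW => w _; have := @approx_integ R T (lam w) W f oW cf f01 fW.
    rewrite -{1}(@fineK _ (lam w W)); last by rewrite fin_num_measure//; exact: open_borel.
    by move/fine_cvg.
move: cl; under eq_cvg do rewrite step.
move=> cl; exact: cvg_unique cl cr.
Unshelve. all: by end_near. Qed.

Lemma finperm_tperm (l n : nat) : finperm (fun k => if k == l then n else if k == n then l else k).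
Proof.
split.
  exists (fun k => if k == l then n else if k == n then l else k) => k /=.
    have [->|kl] := eqVneq k l; first by rewrite eqxx; case: eqVneq.
    have [->|kn] := eqVneq k n; first by rewrite eqxx.
    by rewrite (negbTE kl) (negbTE kn).
  have [->|kl] := eqVneq k l; first by rewrite eqxx; case: eqVneq.
  have [->|kn] := eqVneq k n; first by rewrite eqxx.
  by rewrite (negbTE kl) (negbTE kn).
apply: (@sub_finite_set _ _ [set l; n]); last exact: finite_set2.
move=> k /=; have [->|kl] := eqVneq k l; first by left.
by have [->|kn] := eqVneq k n; [right|].
Qed.

Variable G : set (set Om).
Hypothesis sG : sigma_algebra setT G.
Hypothesis Gm : G `<=` measurable.

Let OmG : measurableType (sigma_display G) := g_sigma_algebraType G.

Let GE (E : set Om) : G E <-> measurable (E : set OmG).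
Proof. by rewrite (_ : @measurable _ OmG = G)//; exact: sigma_algebra_id. Qed.

(** Taking out what is known: the indicator of [D1] and [v] times that of [D2] have the same
    conditional expectation given [G], so a [G]-measurable factor [g] may multiply both. *)
Lemma pull_out_sub (D1 D2 : set Om) (v : Om -> \bar R) (g : Om -> \bar R) :
  measurable D1 -> measurable D2 -> measurable_fun [set: Om] v ->
  (forall w, 0 <= v w) -> (forall w, v w \is a fin_num) ->
  (forall E, G E -> P (E `&` D1) = \int[P]_(w in E `&` D2) v w) ->
  measurable_fun [set: OmG] g -> (forall w, 0 <= g w) ->
  forall E, G E -> \int[P]_(w in E `&` D1) g w = \int[P]_(w in E `&` D2) (g w * v w).
Proof.
move=> mD1 mD2 mv v0 vfin Ev mg g0 E GE'.
have mid : measurable_fun [set: Om] (id : Om -> OmG).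
  by move=> _ A /GE/Gm mA; rewrite setTI.
apply: (@pull_out _ Om R P _ OmG (E `&` D1) (E `&` D2) id id v) => //.
- by apply: measurableI => //; exact: Gm.
- by apply: measurableI => //; exact: Gm.
move=> A mA; rewrite !preimage_id setIAC Ev; first by rewrite setIAC.
by apply/GE; apply: measurableI => //; exact/GE.
Qed.

(** [D] stands for an event of the other classes. Exchangeability is required on each [E]
    intersected with [D], not on [E] alone, and this is what yields conditional independence from
    the other classes. *)
Lemma class_cond o (x : Idx o -> Om -> T) (lam : Om -> Prob T R)
    (F : Prob T R -> Prob (seq_space T o) R) (D : set Om) :
  (forall n, measurable_fun [set: Om] (x n : Om -> borel T)) ->
  measure_vector_comp P x lam ->
  (forall A, measurable A -> measurable_fun [set: probW R T] (fun mu : probW R T => F mu A)) ->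
  (forall w, class_law (fun n => x n w) (lam w) (F (lam w))) ->
  (forall A : set (borel T), measurable A -> measurable_fun [set: OmG] (fun w => lam w A)) ->
  measurable D ->
  (forall E s (A : set (borel (seq_space T o))), G E -> finperm s -> measurable A ->
     P (E `&` D `&` [set w | A (fun n => x (s n) w)]) =
     P (E `&` D `&` [set w | A (fun n => x n w)])) ->
  forall E (A : set (borel (seq_space T o))), G E -> measurable A ->
    P (E `&` D `&` [set w | A (fun n => x n w)]) = \int[P]_(w in E `&` D) F (lam w) A.
Proof.
move=> mx xlam mF clF mlamG mD exch E A GE' mA.
have mlam (B : set (borel T)) : measurable B -> measurable_fun [set: Om] (fun w => lam w B).
  move=> mB _ Y mY; rewrite setTI; apply: Gm; apply/GE.
  by have := mlamG B mB measurableT Y mY; rewrite setTI.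
have mlamW : measurable_fun [set: Om] (lam : Om -> probW R T).
  move=> _ B mB; rewrite setTI; apply: (measurable_fun_probW bU) mB => O oO.
  by apply: mlam; exact: open_borel.
have mED (E' : set Om) : G E' -> measurable (E' `&` D) by move=> GE2; apply: measurableI => //;
    exact: Gm.
have mX : measurable_fun [set: Om] ((fun w n => x n w) : Om -> borel (seq_space T o)).
  exact: (@measurable_fun_seq R T U bU _ Om o (fun w n => x n w)).
have mFl B : measurable B -> measurable_fun [set: Om] (fun w => F (lam w) B).
  by move=> mB; exact: (measurableT_comp (mF B mB) mlamW).
case: o x F mx xlam mF clF exch A mA mX mFl => [k|] x F mx xlam mF clF exch A mA mX mFl.
- have mXs (f : {ffun 'I_k -> 'I_k}) : measurable [set w | A (fun n => x (f n) w)].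
    have h : measurable_fun [set: Om] ((fun w n => x (f n) w) : Om -> borel (seq_space T (Some k))).
      by apply: (@measurable_fun_seq R T U bU _ Om (Some k) (fun w n => x (f n) w)) => n; exact: mx.
    by have := h measurableT A mA; rewrite setTI.
  rewrite (eq_integral (fun w => (((k ^_ k)%:R)^-1)%:E *
      \sum_(f : {ffun 'I_k -> 'I_k} | injectiveb f) (\1_[set w | A (fun n => x (f n) w)]
          w)%:E)); last first.
    by move=> w _; rewrite clF// /lambdaNk; congr (_ * _); apply: eq_bigr => f _; rewrite diracE
        indicE.
  have mind f : measurable_fun (E `&` D) (fun w => (\1_[set w | A (fun n => x ((f : {ffun 'I_k
      -> 'I_k}) n) w)] w : R)%:E).
    by apply/measurable_EFinP; exact: measurable_indic.
  rewrite ge0_integralZl_EFin//; last 3 first.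
  - exact: mED.
  - by move=> w _; rewrite sume_ge0// => f _; rewrite lee_fin.
  - under eq_fun do rewrite big_mkcond; apply: emeasurable_sum => f.
    by case: (injectiveb f) => //; exact: measurable_cst.
  under eq_integral do rewrite big_mkcond.
  rewrite ge0_integral_sum//; last 3 first.
  - exact: mED.
  - by move=> f; case: (injectiveb f) => //; exact: measurable_cst.
  - by move=> f w _; case: (injectiveb f) => //; rewrite lee_fin.
  (* An injective self-map of ['I_k] is a finite permutation, so exchangeability gives the same
     value to each of the [k ^_ k = k!] terms. *)
  rewrite (eq_bigr (fun f : {ffun 'I_k -> 'I_k} => if injectiveb f then
      P (E `&` D `&` [set w | A (fun n => x n w)]) else 0)); last first.
    move=> f _; case: ifPn => [/injectiveP fi|_]; last by rewrite integral0.
    rewrite integral_indic//; last exact: mED.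
    rewrite setIC; apply: exch => //; split; first exact: injF_bij.
    exact: finite_finset.
  rewrite -big_mkcond /=.
  have fin : P (E `&` D `&` [set w | A (fun n => x n w)]) \is a fin_num.
    apply: fin_num_measure; apply: measurableI; first exact: mED.
    by have := mX measurableT A mA; rewrite setTI.
  rewrite -(fineK fin) sumEFin -EFinM; congr EFin.
  have cQ : #|(fun f : {ffun 'I_k -> 'I_k} => injectiveb f)| = (k ^_ k)%N.
    have := card_inj_ffuns 'I_k 'I_k; rewrite !card_ord => <-.
    by apply: eq_card => f; rewrite inE.
  rewrite sumr_const cQ -[X in (_ * X)%R]mulr_natl mulrA mulVf ?mul1r// pnatr_eq0 ffactnn.
  by rewrite -lt0n fact_gt0.
have brects : @measurable _ (borel (seq_space T None)) = <<s rects (fun _ : nat => borel T) >>.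
  exact: (@borel_prod_rects nat (fun _ => T) (fun _ => U)).
have rI : setI_closed (rects (fun _ : nat => borel T) : set (set (borel (seq_space T None)))).
  exact: (@rects_setI nat _ (fun _ => borel T)).
apply: (@pi_system_integral _ (borel (seq_space T None)) R _ brects rI _ Om P (F \o lam)
  (fun w n => x n w) (E `&` D) mX (mED _ GE') mFl) A mA => _ [s [B [us mB BT ->]]].
pose m := (\max_(i <- s) i.+1)%N.
have sm i : i \in s -> (i < m)%N by move=> si; exact: (@leq_bigmax_seq _ s xpredT (fun i =>
    i.+1) i si isT).
have BTm i : (m <= i)%N -> B i = setT.
  by move=> mi; apply: BT; apply/negP => /sm; rewrite ltnNge mi.
pose H n := [set w | forall j, (j < n)%N -> B j (x j w)].
have mH n : measurable (H n).
  rewrite (_ : H n = \bigcap_j (if (j < n)%N then x j @^-1` B j else setT)).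
    apply: bigcapT_measurable => j; case: ifP => // _.
    by rewrite -[X in measurable X]setTI; apply: mx.
  apply/seteqP; split => w /= h j; first by move=> _; case: ifP => // jn; exact: h.
  by move=> jn; have := h j Logic.I; rewrite jn.
(* The coordinates are replaced by [lam] one at a time, starting from the last one. *)
have key n : forall E', G E' -> P (E' `&` (D `&` H n)) =
    \int[P]_(w in E' `&` D) (\prod_(j < n) lam w (B j)).
  elim: n => [|n ih] E' GE2.
    rewrite (_ : H 0%N = setT) ?setIT; last by apply/seteqP; split.
    under eq_integral do rewrite big_ord0.
    by rewrite integral_cst ?mul1e//; exact: mED.
  have HS : H n.+1 = H n `&` x n @^-1` B n.
    apply/seteqP; split => w /=.
      by move=> h; split => [j jn|]; apply: h => //; exact: ltnW.
    move=> [h1 h2] j; rewrite ltnS leq_eqVlt => /orP[/eqP->//|]; exact: h1.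
  rewrite HS setIA setIA -(setIA E').
  rewrite (@exch_coord x lam (E' `&` (D `&` H n)) n n)//; last 2 first.
  - by apply: measurableI; [exact: Gm|exact: measurableI].
  - move=> l C nl mC.
    (* As [n <= l], this transposition fixes the coordinates below [n], hence the constraints of
       [H n]. *)
    pose sg := fun k => if k == n then l else if k == l then n else k.
    pose A' : set (borel (seq_space T None)) := [set z | (forall j, (j < n)%N -> B j (z j)) /\ C
        (z n)].
    have mA' : measurable A'.
      rewrite (_ : A' = (\bigcap_j (if (j < n)%N then (fun z : borel (seq_space T None) => z j)
          @^-1` B j else setT)) `&` (fun z : borel (seq_space T None) => z n) @^-1` C).
        apply: measurableI.
          apply: bigcapT_measurable => j; case: ifP => // _.
          by rewrite -[X in measurable X]setTI; exact: (@measurable_seq_coord R T None j).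
        by rewrite -[X in measurable X]setTI; exact: (@measurable_seq_coord R T None n).
      apply/seteqP; split => z /= [h1 h2]; split => //.
        by move=> j _; case: ifP => // jn; exact: h1.
      by move=> j jn; have := h1 j Logic.I; rewrite jn.
    have := exch E' sg A' GE2 (finperm_tperm n l) mA'.
    have -> : E' `&` D `&` [set w | A' (fun k => x (sg k) w)] = E' `&` (D `&` H n) `&` x l @^-1` C.
      rewrite -!setIA; congr (_ `&` (_ `&` _)); apply/seteqP; split => w /= [h1 h2]; split.
      + move=> j jn; have := h1 j jn.
        by rewrite /sg ltn_eqF// ltn_eqF// (leq_trans jn).
      + by move: h2; rewrite /sg eqxx.
      + move=> j jn; have := h1 j jn.
        by rewrite /sg ltn_eqF// ltn_eqF// (leq_trans jn).
      + by rewrite /sg eqxx.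
    have -> : E' `&` D `&` [set w | A' (fun k => x k w)] = E' `&` (D `&` H n) `&` x n @^-1` C.
      by rewrite -!setIA; congr (_ `&` (_ `&` _)); apply/seteqP; split => w.
    by [].
  (* [lam w (B n)] is [G]-measurable, so the induction hypothesis can replace [H n] by the product
     over [j < n] under the integral. *)
  rewrite (@pull_out_sub (D `&` H n) D (fun w => \prod_(j < n) lam w (B j)) (fun w => lam w (B
      n)))//.
  - by apply: eq_integral => w _; rewrite big_ord_recr /= muleC.
  - exact: measurableI.
  - by apply: measurable_prode => j; exact: mlam.
  - by move=> w; apply: prode_ge0.
  - by move=> w; apply: prode_fin_num => j _; apply: fin_num_measure; exact: mB.
  - exact: mlamG.
have -> : (fun w n => x n w) @^-1` (rect s B) = H m.
  rewrite rectT//; apply/seteqP; split => w /= h j; first by move=> _; exact: h.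
  by have [/h//|/BTm->] := ltnP j m.
rewrite -setIA key//; apply: eq_integral => w _ /=.
have := clF w m (fun j => B j) (fun j => mB j).
rewrite rectT// => <-; congr (F (lam w) _); apply/seteqP; split => y /= h j; last exact: h.
by have [jm|/BTm->//] := ltnP j m; have := h (Ordinal jm).
Qed.

End exchangeable_class.

(** * Permutation-invariant versions of the measure vector *)

Section symmetric_statistic.
Local Open Scope ereal_scope.

(** Once [M] exceeds the support of [s], the permutation maps the initial segment of length [M] onto
    itself. *)
Lemma finperm_sum (R : realType) (s : nat -> nat) (a : nat -> R) : finperm s ->
  \forall M \near \oo, (\sum_(n < M) a (s n) = \sum_(n < M) a n)%R.
Proof.
move=> [bs /finite_setP[m0 sm0]].
have [m sm] : exists m, forall n, (m <= n)%N -> s n = n.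
  have fs : finite_set [set n | s n <> n] by apply/finite_setP; exists m0.
  have /finite_seqP[l lE] := fs.
  exists (\max_(i <- l) i.+1)%N => n mn; apply: contrapT => sn.
  have nl : n \in l by have : [set` l] n by rewrite -lE.
  have := @leq_bigmax_seq _ l xpredT (fun i => i.+1) n nl isT.
  by move=> /leq_trans/(_ mn); rewrite ltnn.
near=> M; have mM : (m <= M)%N by near: M; exists m.
have sM n : (n < M)%N -> (s n < M)%N.
  move=> nM; have [->//|snn] := pselect (s n = n).
  rewrite ltnNge; apply/negP => Msn; apply: snn.
  by apply: (bij_inj bs); apply: sm; exact: leq_trans Msn.
pose t (i : 'I_M) : 'I_M := Ordinal (sM _ (ltn_ord i)).
have ti : injective t by move=> i j /(congr1 val) /(bij_inj bs) /val_inj.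
by rewrite [RHS](reindex t)//; exact/onW_bij/injF_bij.
Unshelve. all: by end_near. Qed.

Lemma limn_esup_near_eq (R : realType) (u v : nat -> \bar R) :
  (\forall n \near \oo, u n = v n) -> limn_esup u = limn_esup v.
Proof.
have le (u' v' : nat -> \bar R) : (\forall n \near \oo, u' n = v' n) ->
    limn_esup u' <= limn_esup v'.
  move=> [m _ uv]; rewrite !limn_esup_lim; apply: lee_lim; [exact: is_cvg_esups..|].
  near=> n; have mn : (m <= n)%N by near: n; exists m.
  apply: le_ereal_sup => _ [k /= nk <-]; exists k => //.
  by rewrite uv//=; exact: leq_trans nk.
move=> uv; apply/eqP; rewrite eq_le le//= le//.
by apply: filterS uv => n.
Unshelve. all: by end_near. Qed.

Context d (Om : measurableType d) (R : realType) (P : probability Om R)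
  (T : completePseudoMetricType R) (U : nat -> set T).
Hypothesis bU : countable_basis U.

(* For an infinite class the weak limit of the empirical measures is, on an open
   set, an iterated limsup of averages of continuous functions. *)
Lemma symmetric_statistic o (x : Idx o -> Om -> T) (lam : Om -> Prob T R) (W : set T) :
  (forall n, measurable_fun [set: Om] (x n : Om -> borel T)) ->
  measure_vector_comp P x lam -> open W ->
  exists g : seq_space T o -> \bar R,
   [/\ measurable_fun [set: borel (seq_space T o)] (g : borel (seq_space T o) -> \bar R),
       forall s z, finperm s -> g (fun n => z (s n)) = g z,
       {ae P, forall w, lam w W = g (fun n => x n w)} &
       measurable_fun [set: Om] (fun w => lam w W)].
Proof.
move=> mx xlam oW.
have mX : measurable_fun [set: Om] ((fun w n => x n w) : Om -> borel (seq_space T o)).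
  exact: (@measurable_fun_seq R T U bU _ Om o (fun w n => x n w)).
have mW : measurable (W : set (borel T)) by exact: open_borel.
have mco n : measurable_fun [set: borel (seq_space T o)]
    ((fun z => z n) : borel (seq_space T o) -> borel T) by exact: measurable_seq_coord.
case: o x mx xlam mX mco => [k|] x mx xlam mX mco.
  pose g (z : seq_space T (Some k)) : \bar R := @empirical T R k z W.
  have mg : measurable_fun [set: borel (seq_space T (Some k))] (g : borel (seq_space T (Some k))
      -> \bar R).
    apply: measurable_funeM; apply: emeasurable_sum => n.
    apply/measurable_EFinP.
    have := measurableT_comp (@measurable_indic _ (borel T) R setT W mW) (mco n).
    exact.
  exists g; split => //.
  - move=> s z [bs _]; rewrite /g /empirical; congr (_ * _).
    by rewrite [RHS](reindex s)//; exact: onW_bij.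
  - by apply: aeW => w; exact: xlam.
  - rewrite (_ : (fun w => _) = g \o (fun w n => x n w)).
      exact: (measurableT_comp mg mX).
    by apply/funext => w; exact: xlam.
have [mlam cvlam] := xlam.
have [f [cf f01 fW]] := open_approx oW.
have bf p : bcont (f p).
  split; first exact: cf.
  by exists 1%R => z; have /andP[f0 f1] := f01 p z; rewrite ger0_norm.
pose av p M (z : nat -> T) : R := (M.+1%:R^-1 * \sum_(n < M.+1) f p (z n))%R.
(* A limsup, unlike a limit, is defined, measurable and exactly invariant at every [z], while the
   averages converge only almost surely. *)
pose g (z : seq_space T None) : \bar R :=
  limn_esup (fun p => limn_esup (fun M => (av p M z)%:E)).
exists g; split.
- apply: measurable_fun_limn_esup => p; apply: measurable_fun_limn_esup => M.
  apply/measurable_EFinP; apply: measurable_funM => //; apply: measurable_sum => n.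
  exact: (measurableT_comp (continuous_measurable (cf p)) (mco n)).
- move=> s z fs; rewrite /g; congr limn_esup; apply/funext => p.
  apply: limn_esup_near_eq.
  have [m _ h] := finperm_sum (fun n => f p (z n)) fs.
  by exists m => // M mM; rewrite /av h//=; exact: leqW.
- apply: filterS cvlam => w cvw.
  have av_cvg p : limn_esup (fun M => (av p M (fun n => x n w))%:E) = (integ (lam w) (f p))%:E.
    apply: (cvg_limn_einf_sup _).2; apply: cvg_EFin; first exact: nearW.
    exact: cvw.
  rewrite /g (_ : (fun p => _) = (fun p => (integ (lam w) (f p))%:E)); last first.
    by apply/funext => p; exact: av_cvg.
  by rewrite (cvg_limn_einf_sup (@approx_integ R T (lam w) W f oW cf f01 fW)).2.
- have h : measurable_fun [set: Om] (lam : Om -> probW R T).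
    by move=> _ B mB; rewrite setTI; exact: mlam.
  exact: (measurableT_comp (measurable_ev mW) h).
Qed.

End symmetric_statistic.

(** * Conditional law of the whole system *)

Section multi_exchangeable_system.
Local Open Scope ereal_scope.
Context (R : realType) (d : measure_display) (Omega : measurableType d)
  (P : probability Omega R) (C : nat) (N : 'I_C -> option nat)
  (S : 'I_C -> completePseudoMetricType R)
  (X : forall i, Idx (N i) -> Omega -> S i) (Lam : forall i, Omega -> Prob (S i) R).
Arguments X : clear implicits.
Arguments Lam : clear implicits.
Hypothesis HS : forall i, exists U : nat -> set (S i), countable_basis U.
Hypothesis HXm : forall i n, measurable_fun setT (X i n : Omega -> borel (S i)).
Hypothesis Hex : multi_exchangeable P X.
Hypothesis HLam : forall i, measure_vector_comp P (X i) (Lam i).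

Local Notation Sys := (system_space S N).
Local Notation classT i := (seq_space (S i) (N i)).

Let Y (w : Omega) : Sys := fun i n => X i n w.

Let act (sg : forall i, Idx (N i) -> Idx (N i)) (z : Sys) : Sys := fun i n => z i (sg i n).

Arguments Y : clear implicits.
Arguments act : clear implicits.

Lemma class_countable_basis : exists V : forall i, nat -> set (classT i), forall i,
    countable_basis (V i).
Proof.
have H i : exists V : nat -> set (classT i), countable_basis V.
  by have [U bU] := HS i; exact: (seq_space_countable_basis bU).
by exists (fun i => projT1 (cid (H i))) => i; exact: (projT2 (cid (H i))).
Qed.

Let measurable_class i : measurable_fun [set: borel Sys] ((fun z => z i) : borel Sys -> borel
    (classT i)).
Proof. exact: (@measurable_proj 'I_C (fun i => classT i) i). Qed.

Let measurable_sys d' (Z : measurableType d') (f : Z -> Sys) :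
  (forall i n, measurable_fun [set: Z] ((fun z => f z i n) : Z -> borel (S i))) ->
  measurable_fun [set: Z] (f : Z -> borel Sys).
Proof.
move=> mf; have [V bV] := class_countable_basis.
apply: (@measurable_fun_prod _ Z 'I_C (fun i => classT i) V f bV) => i.
have [U bU] := HS i.
exact: (@measurable_fun_seq R (S i) U bU _ Z (N i) (fun z => f z i)).
Qed.

Let measurable_Y : measurable_fun [set: Omega] (Y : Omega -> borel Sys).
Proof. exact: measurable_sys. Qed.

Let measurable_act sg : measurable_fun [set: borel Sys] (act sg : borel Sys -> borel Sys).
Proof.
apply: measurable_sys => i n.
have h := measurableT_comp (@measurable_seq_coord R (S i) (N i) (sg i n)) (@measurable_class i).
exact: h.
Qed.

Let preY (A : set (borel Sys)) : measurable A -> measurable [set w | A (Y w)].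
Proof. by move=> mA; have := measurable_Y measurableT mA; rewrite setTI. Qed.

Let preact sg (A : set (borel Sys)) : measurable A -> measurable [set z : borel Sys | A (act sg z)].
Proof. by move=> mA; have := @measurable_act sg measurableT A mA; rewrite setTI. Qed.

(* Events that coincide almost surely with a permutation-invariant event of the
   system. *)
Let good : set (set Omega) := [set E | measurable E /\ exists A : set (borel Sys),
  [/\ measurable A, forall sg, (forall i, finperm (sg i)) -> forall z, A (act sg z) <-> A z &
      {ae P, forall w, E w <-> A (Y w)}]].

Let good_sigma : sigma_algebra setT good.
Proof.
split.
- split => //; exists set0; split => //; exact: aeW.
- move=> E [mE [A [mA Ainv EA]]]; split; first by rewrite setTD; exact: measurableC.
  exists (~` A); split.
  + exact: measurableC.
  + by move=> sg fsg z; split => nA h; apply: nA; exact/(Ainv sg fsg z).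
  + by apply: filterS EA => w EA; split => [[_ nE] /EA//|nA]; split => // /EA.
- move=> E gE; split; first by apply: bigcupT_measurable => n; exact: (gE n).1.
  have /choice[A AP] : forall n, exists A : set (borel Sys), [/\ measurable A,
      forall sg, (forall i, finperm (sg i)) -> forall z, A (act sg z) <-> A z &
      {ae P, forall w, E n w <-> A (Y w)}] by move=> n; exact: (gE n).2.
  exists (\bigcup_n A n); split.
  + by apply: bigcupT_measurable => n; have [] := AP n.
  + move=> sg fsg z; split => -[n _ h]; exists n => //.
      by have [_ inv _] := AP n; exact/(inv sg).
    by have [_ inv _] := AP n; exact/(inv sg).
  + have /ae_foralln h : forall n, {ae P, forall w, E n w <-> A n (Y w)}.
      by move=> n; have [] := AP n.
    by apply: filterS h => w h; split => -[n _ En]; exists n => //; apply/h.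
Qed.

(** With [good] itself as the source sigma-algebra, [measurable_fun_probW] reduces weak Borel sets
    to masses of open sets, for which [symmetric_statistic] supplies the invariant version. *)
Let good_Lam i B : weak_borel (S i) R B -> good (Lam i @^-1` B).
Proof.
have [U bU] := HS i => wB.
rewrite -(sigma_algebra_id good_sigma).
apply: (@measurable_fun_probW R (S i) U bU _ (g_sigma_algebraType good) (Lam i)) wB => W oW _ D mD.
rewrite setTI; apply: sub_sigma_algebra.
have [g [mg gsym gE mlam]] := symmetric_statistic bU (@HXm i) (HLam i) oW.
split; first by have := mlam measurableT D mD; rewrite setTI.
exists [set z : borel Sys | D (g (z i))]; split.
- have := measurableT_comp mg (@measurable_class i) => /(_ measurableT D mD).
  by rewrite setTI.
- move=> sg fsg z /=; rewrite -[in X in _ <-> X](gsym (sg i) (z i))//.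
- by apply: filterS gE => w wE /=; rewrite wE.
Qed.

Let sG : sigma_algebra setT (sigma_gen Lam).
Proof. exact: smallest_sigma_algebra. Qed.

Let gen_good : sigma_gen Lam `<=` good.
Proof.
apply: smallest_sub; first exact: good_sigma.
by move=> _ [i _ [B wB <-]]; exact: good_Lam.
Qed.

Let Gm : sigma_gen Lam `<=` measurable.
Proof. by move=> E /gen_good[]. Qed.

Let OmG : measurableType (sigma_display (sigma_gen Lam)) := g_sigma_algebraType (sigma_gen Lam).

Let measurable_LamG i : measurable_fun [set: OmG] (Lam i : OmG -> probW R (S i)).
Proof.
move=> _ B mB; rewrite setTI; apply: sub_sigma_algebra; apply: sub_sigma_algebra.
by exists i => //; exists B.
Qed.

(** Replacing [E] by its invariant version [B] makes the whole event one of the system;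
    multi-exchangeability then permutes [A] and leaves [B] in place. *)
Lemma invariance E sg (A : set (borel Sys)) : sigma_gen Lam E -> (forall i, finperm (sg i)) ->
  measurable A -> P (E `&` [set w | A (act sg (Y w))]) = P (E `&` [set w | A (Y w)]).
Proof.
move=> /gen_good[mE [B [mB Binv EB]]] fsg mA.
have step (D : set (borel Sys)) : measurable D ->
    P (E `&` [set w | D (Y w)]) = P [set w | B (Y w) /\ D (Y w)].
  move=> mD; apply: ae_iff_measure.
  - by apply: measurableI => //; exact: preY.
  - by apply: (@measurableI _ _ [set w | B (Y w)] [set w | D (Y w)]); exact: preY.
  - by apply: filterS EB => w EB /=; split => -[/EB].
rewrite (step [set z | A (act sg z)]); last exact: preact.
rewrite (step A)//.
have := Hex fsg (measurableI _ _ mB mA).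
rewrite (_ : [set w | _] = [set w | B (Y w) /\ A (act sg (Y w))]) => [->//|].
apply/seteqP; split => w /= [h1 h2]; split => //; first exact/(Binv sg).
exact/(Binv sg fsg (Y w)).
Qed.

Context (F : forall i, Prob (S i) R -> Prob (classT i) R).
Arguments F : clear implicits.
Hypothesis mF : forall i (A : set (borel (classT i))), measurable A ->
  measurable_fun [set: probW R (S i)] (fun mu : probW R (S i) => F i mu A).
Hypothesis clF : forall i w, class_law (fun n => X i n w) (Lam i w) (F i (Lam i w)).

Let mFG i (A : set (borel (classT i))) : measurable A ->
  measurable_fun [set: OmG] (fun w => F i (Lam i w) A).
Proof.
move=> mA; have h := measurableT_comp (@mF i A mA) (@measurable_LamG i); exact: h.
Qed.

Let subG (f : Omega -> \bar R) : measurable_fun [set: OmG] f -> measurable_fun [set: Omega] f.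
Proof.
move=> mf _ A mA; rewrite setTI; apply: Gm.
have := mf measurableT A mA; rewrite setTI.
by rewrite /measurable /= (sigma_algebra_id sG).
Qed.

Lemma system_cond_rect (A : forall i, set (borel (classT i))) E :
  (forall i, measurable (A i)) -> sigma_gen Lam E ->
  P (E `&` [set w | forall i, A i (Y w i)]) = \int[P]_(w in E) \prod_(i < C) F i (Lam i w) (A i).
Proof.
move=> mA GE.
have mXA i : measurable [set w | A i (Y w i)].
  have := measurableT_comp (@measurable_class i) measurable_Y.
  by move=> /(_ measurableT (A i) (mA i)); rewrite setTI.
pose H c := [set w | forall i : 'I_C, (c <= i)%N -> A i (Y w i)].
have mH c : measurable (H c).
  rewrite (_ : H c = \bigcap_(i : 'I_C) (if (c <= i)%N then [set w | A i (Y w i)] else setT)).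
    apply: fin_bigcap_measurable => // i _; by case: ifP.
  apply/seteqP; split => w /= h i; first by move=> _; case: ifP => // /h.
  by move=> ci; have := h i Logic.I; rewrite ci.
pose f c w := \prod_(i < C) (if (i < c)%N then F i (Lam i w) (A i) else 1).
(* At stage [c] the constraints on the classes below [c] have become kernel factors, gathered in
   [f c], and [H c] keeps the constraints on the others. Class [c] is converted next, with [H c.+1]
   as the event [D] of [class_cond]. *)
have key c : (c <= C)%N -> P (E `&` H 0%N) = \int[P]_(w in E `&` H c) f c w.
  elim: c => [_|c ih cC].
    rewrite (eq_integral (cst 1)); last by move=> w _; rewrite /f big1.
    by rewrite integral_cst ?mul1e//; apply: measurableI => //; exact: Gm.
  rewrite (ih (ltnW cC)); pose i0 : 'I_C := Ordinal cC.
  have HE : H c = H c.+1 `&` [set w | A i0 (Y w i0)].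
    apply/seteqP; split => w /=.
      by move=> h; split => [i ci|]; apply: h => //; exact: ltnW.
    move=> [h1 h2] i; rewrite leq_eqVlt => /orP[/eqP ci|]; last exact: h1.
    by have -> : i = i0 by exact: val_inj.
  have [U0 bU0] := HS i0.
  have cond := @class_cond _ Omega R P (S i0) U0 bU0 (sigma_gen Lam) sG Gm (N i0) (X i0) (Lam i0)
    (F i0) (H c.+1) (@HXm i0) (HLam i0) (@mF i0) (clF i0).
  (* The factors [f c] already obtained are functions of the measure vector, so they pass unchanged
     through the conversion of class [c]. *)
  rewrite (@pull_out_sub _ Omega R P (sigma_gen Lam) sG Gm (H c) (H c.+1)
    (fun w => F i0 (Lam i0 w) (A i0)) (f c))//.
  - apply: eq_integral => w _; rewrite /f [in RHS](bigD1 i0)//= ltnSn (bigD1 i0)//= ltnn mul1e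
      muleC.
    congr (_ * _); apply: eq_bigr => i ii0.
    have -> // : (i < c.+1)%N = (i < c)%N.
    rewrite ltnS leq_eqVlt; case: eqP => //= ic.
    by case/negP: ii0; apply/eqP/val_inj.
  - by apply: subG; exact: mFG.
  - by move=> w; rewrite fin_num_measure.
  - move=> E' GE'; rewrite HE setIA; apply: cond => //.
    + move=> B mB; exact: (measurableT_comp (@measurable_ev R (S i0) B mB) (@measurable_LamG i0)).
    + move=> E2 s B GE2 fs mB.
      (* Only class [i0] is permuted, so the constraints [H c.+1] on later classes are untouched. *)
      pose sg := dfwith (T := fun i => Idx (N i) -> Idx (N i)) (fun i => id) i0 s.
      have fsg i : finperm (sg i).
        have [<-|ii0] := eqVneq i0 i; first by rewrite /sg dfwithin.
        rewrite /sg dfwithout//; split; first by exists id.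
        by rewrite (_ : [set x | _] = set0)//; apply/seteqP; split.
      pose A' : set (borel Sys) := [set z | (forall i : 'I_C, (c.+1 <= i)%N -> A i (z i)) /\ B
          (z i0)].
      have mA' : measurable A'.
        rewrite (_ : A' = \bigcap_(i : 'I_C) (if (c.+1 <= i)%N then [set z : borel Sys | A i (z
            i)] else setT) `&` [set z : borel Sys | B (z i0)]).
          apply: measurableI; last by have := @measurable_class i0 measurableT B mB; rewrite setTI.
          apply: fin_bigcap_measurable => // i _; case: ifP => // _.
          by have := @measurable_class i measurableT _ (mA i); rewrite setTI.
        apply/seteqP; split => z /= [h1 h2]; split => // i; first by move=> _; case: ifP => // /h1.
        by move=> ci; have := h1 i Logic.I; rewrite ci.
      have := invariance GE2 fsg mA'.
      rewrite (_ : E2 `&` [set w | A' (act sg (Y w))] = E2 `&` H c.+1 `&` [set w | B (fun n => X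
          i0 (s n) w)]).
        move=> ->; congr (P _); rewrite -setIA; congr (_ `&` _).
      rewrite -setIA; congr (_ `&` _).
      have e0 w : act sg (Y w) i0 = (fun n => X i0 (s n) w) by rewrite /act /sg dfwithin.
      have e1 w (i : 'I_C) : (c < i)%N -> act sg (Y w) i = Y w i.
        by move=> ci; rewrite /act /sg dfwithout// -val_eqE /= ltn_eqF.
      apply/seteqP; split => w /= [h1 h2].
        split; last by rewrite -e0.
        by move=> i ci; have := h1 i ci; rewrite e1.
      split; last by rewrite e0.
      by move=> i ci; rewrite e1//; exact: h1.
  - by apply: measurable_prode => i; case: (i < c)%N; [exact: mFG|exact: measurable_cst].
  - by move=> w; apply: prode_ge0 => i _; case: ifP.
rewrite (_ : [set w | _] = H 0%N); last first.
  by apply/seteqP; split => w /= h i; [move=> _|]; exact: h.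
rewrite (key C)// (_ : H C = setT) ?setIT; last first.
  by apply/seteqP; split => // w _ i; rewrite leqNgt ltn_ord.
by apply: eq_integral => w _; apply: eq_bigr => i _; rewrite ltn_ord.
Qed.

(** [K w] is chosen separately for each [w]. It is nevertheless measurable in [w], since its masses
    on rectangles are products of measurable kernels and rectangles form a generating pi-system. *)
Lemma system_cond_law : exists K : Omega -> Prob Sys R,
  (forall w, is_product_measure (fun i => F i (Lam i w)) (K w)) /\
  cond_law P (sigma_gen Lam) Y K.
Proof.
have [V bV] := class_countable_basis.
have /choice[K KE] : forall w, exists K : Prob Sys R, forall s (A : forall i, set (borel (classT
    i))),
    uniq s -> (forall i, measurable (A i)) ->
    K (rect s A) = \prod_(i <- s) F i (Lam i w) (A i).
  move=> w.
  exact: (@borel_product_measure R 'I_C (fun i => classT i) V (fun i => F i (Lam i w)) bV).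
have KT w (A : forall i, set (borel (classT i))) : (forall i, measurable (A i)) ->
    K w [set y : borel Sys | forall i, A i (y i)] = \prod_(i < C) F i (Lam i w) (A i).
  move=> mA; rewrite (_ : [set y | _] = rect (index_enum 'I_C) A).
    by rewrite KE ?index_enum_uniq.
  apply/seteqP; split => y /= h i; first by move=> _; exact: h.
  by apply: h; exact: mem_index_enum.
exists K; split; first by move=> w A mA; exact: KT.
have brects : @measurable _ (borel Sys) = <<s rects (fun i : 'I_C => borel (classT i)) >>.
  exact: (@borel_prod_rects 'I_C (fun i => classT i) V).
have rI : setI_closed (rects (fun i : 'I_C => borel (classT i)) : set (set (borel Sys))).
  exact: (@rects_setI 'I_C _ (fun i => borel (classT i))).
have mKG (A : set (borel Sys)) : measurable A -> measurable_fun [set: OmG] (fun w => K w A).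
  apply: (@pi_system_measurable _ (borel Sys) R _ brects rI _ OmG K) => _ [s [B [us mB BT ->]]].
  rewrite (_ : (fun z => _) = (fun w => \prod_(i <- s) F i (Lam i w) (B i))); last first.
    by apply/funext => w; exact: KE.
  by apply: measurable_prode => i; exact: mFG.
move=> A mA; split.
  move=> B mB; have := mKG A mA measurableT B mB; rewrite setTI.
  by rewrite /measurable /= (sigma_algebra_id sG).
move=> E GE; apply: (@pi_system_integral _ (borel Sys) R _ brects rI _ Omega P K Y E
    measurable_Y (Gm GE)) mA.
  by move=> B mB; apply: subG; exact: mKG.
move=> _ [s [B [us mB BT ->]]]; rewrite rectT//.
rewrite (eq_integral (fun w => \prod_(i < C) F i (Lam i w) (B i))); last by move=> w _; exact: KT.
exact: system_cond_rect.
Qed.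

End multi_exchangeable_system.

Theorem theorem3 (R : realType) (d : measure_display) (Omega : measurableType d)
  (P : probability Omega R)
  (C : nat) (HC : (0 < C)%N)
  (N : 'I_C -> option nat) (HN : forall i k, N i = Some k -> (0 < k)%N)
  (S : 'I_C -> completePseudoMetricType R) (HS : forall i, polish (S i))
  (X : forall i, Idx (N i) -> Omega -> S i)
  (HXm : forall i n, measurable_fun setT (X i n : Omega -> borel (S i)))
  (Hex : multi_exchangeable P X)
  (Lam : forall i, Omega -> Prob (S i) R)
  (HLam : forall i, measure_vector_comp P (X i) (Lam i)) :
  exists F : forall i, Prob (S i) R -> Prob (seq_space (S i) (N i)) R,
    (forall i B, weak_borel (seq_space (S i) (N i)) R B ->
                 weak_borel (S i) R (F i @^-1` B)) /\
    (forall i w, class_law (fun n => X i n w) (Lam i w) (F i (Lam i w))) /\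
    exists K : Omega -> Prob (system_space S N) R,
      (forall w, is_product_measure (fun i => F i (Lam i w)) (K w)) /\
      cond_law P (sigma_gen Lam) (fun w => (fun i n => X i n w) : system_space S N) K.
Proof.
have HS' i : exists U : nat -> set (S i), countable_basis U by exact: polish_countable_basis (HS i).
have HF i : exists F : Prob (S i) R -> Prob (seq_space (S i) (N i)) R,
    (forall A, measurable A ->
       measurable_fun [set: probW R (S i)] (fun mu : probW R (S i) => F mu A)) /\
    (forall x lam, @finite_class_cond R (S i) (N i) x lam -> class_law x lam (F lam)).
  by have [U bU] := HS' i; exact: (class_kernel bU (HN i)).
pose F i := projT1 (cid (HF i)).
have mF i := (projT2 (cid (HF i))).1.
have clF i w : class_law (fun n => X i n w) (Lam i w) (F i (Lam i w)).
  apply: (projT2 (cid (HF i))).2.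
  (* For a finite class the measure vector is the empirical measure at every [w], which is exactly
     [finite_class_cond]; the class law thus holds everywhere and not just almost surely. *)
  by case: (N i) (X i) (HLam i) => [k|] x //= xlam; exact: xlam.
exists F; split; [|split => //].
  move=> i B wB; have [U bU] := HS' i; have [V bV] := @seq_space_countable_basis R (S i) U bU (N i).
  apply: (@measurable_fun_probW R (seq_space (S i) (N i)) V bV _ (probW R (S i)) (F i)) wB.
  by move=> W oW; apply: mF; exact: open_borel.
exact: (system_cond_law HS' HXm Hex HLam mF clF).
Qed.
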